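(* Let $\delta\ge 0$, $M\ge 0$, and let $(X,d)$ be an $M$-roughly starlike $\delta$-Gromov hyperbolic space. Fix a base point $p\in X$ and $\epsilon>0$, and let $X^{\epsilon}=(X,d_\epsilon)$ be the uniformized space. Then the following are equivalent: (1) the Gehring-Hayman property for metric boundary points holds for $X^\epsilon$; (2) the canonical boundary map $\Phi:\partial_G X\to\partial_{d_\epsilon}X^\epsilon$ is bijective and the Gehring-Hayman property for Gromov sequences holds for $X^\epsilon$; (3) the Gehring-Hayman theorem holds for $X^\epsilon$; (4) $X^\epsilon$ is a uniform space (i.e. $A$-uniform for some $A>0$).
   Context: For $x,y,p$ in a metric space $(X,d)$, the Gromov product is $(x|y)_p=\frac12(d(p,x)+d(p,y)-d(x,y))$. $(X,d)$ is $\delta$-Gromov hyperbolic if it is unbounded, proper, geodesic, and $(x|z)_p\ge \min\{(x|y)_p,(y|z)_p\}-\delta$ for all $x,y,z,p\in X$. $(X,d)$ is $M$-roughly starlike if there is a point $o\in X$ such that for every $x\in X$ there is a geodesic ray $\gamma:[0,\infty)\to X$ with $\gamma(0)=o$ and $\mathrm{dist}_d(x,\gamma)\le M$. Uniformization: for $\epsilon>0$ and base point $p$, set $\rho_\epsilon(z)=e^{-\epsilon d(p,z)}$ and $d_\epsilon(x,y)=\inf_\gamma\int_\gamma\rho_\epsilon\,ds$, infimum over all $d$-rectifiable curves from $x$ to $y$ (integral with respect to $d$-arclength). $X^\epsilon=(X,d_\epsilon)$; $l_{d_\epsilon}(\gamma)$ denotes the length of a curve with respect to $d_\epsilon$. The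 metric boundary is $\partial_{d_\epsilon}X^\epsilon=\overline{X^\epsilon}\setminus X^\epsilon$, closure in the completion. $[x,y]$ denotes a $d$-geodesic from $x$ to $y$. Gromov boundary $\partial_G X$: the set of geodesic rays $\gamma$ with $\gamma(0)=p$ modulo the equivalence $\gamma\sim\tilde\gamma$ iff $\sup_{t\ge0}d(\gamma(t),\tilde\gamma(t))<\infty$. The canonical boundary map $\Phi:\partial_GX\to\partial_{d_\epsilon}X^\epsilon$ sends $[\gamma]$ to the $d_\epsilon$-limit of $\gamma(k)$ as $k\to\infty$ (this limit exists and is independent of the representative). A Gromov sequence is $(x_n)\subseteq X$ with $(x_n|x_m)_p\to\infty$ as $n,m\to\infty$; two Gromov sequences $(x_n),(y_n)$ are equivalent if $(x_n|y_n)_p\to\infty$. The Gehring-Hayman theorem holds for $X^\epsilon$ if there is $A>0$ with $l_{d_\epsilon}([x,y])\le A\,d_\epsilon(x,y)$ for all $x,y\in X$ and every $d$-geodesic $[x,y]$. The Gehring-Hayman property for Gromov sequences holds if for each Gromov sequence $(x_n)$ there is $C\ge1$ (possibly depending on the sequence) with $l_{d_\epsilon}([x_n,x_m])\le C d_\epsilon(x_n,x_m)$ for all $n,m$. The Gehring-Hayman property for metric boundary points holds if for every $x\in\partial_{d_\epsilon}X^\epsilon$ and every sequence $(x_n)\subseteq X$ with $d_\epsilon(x_n,x)\to0$ there is $C\ge1$ with $l_{d_\epsilon}([x_n,x_m])\le Cd_\epsilon(x_n,x_m)$ for all $n,m$. For a metric space $(Y,\varrho)$ with metric boundary $\partial_\varrho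 Y=\overline Y\setminus Y$, a curve $\gamma:[a,b]\to Y$ is $A$-uniform if $l_\varrho(\gamma)\le A\varrho(\gamma(a),\gamma(b))$ and $\min\{l_\varrho(\gamma|_{[a,t]}),l_\varrho(\gamma|_{[t,b]})\}\le A\,\mathrm{dist}_\varrho(\gamma(t),\partial_\varrho Y)$ for all $t\in[a,b]$. A noncomplete locally compact metric space is $A$-uniform if every pair of points is joined by an $A$-uniform curve. *)

(* Defs.v *)
From Stdlib Require Import Reals.
From Coquelicot Require Import Coquelicot.
Open Scope R_scope.

Section Defs.
Context {X : Type}.

Definition is_metric (D : X -> X -> R) : Prop :=
  (forall x y, 0 <= D x y) /\
  (forall x y, D x y = 0 <-> x = y) /\
  (forall x y, D x y = D y x) /\
  (forall x y z, D x z <= D x y + D y z).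

Fixpoint sumlt (f : nat -> R) (n : nat) : R :=
  match n with O => 0 | S k => sumlt f k + f k end.

Definition is_partition (a b : R) (n : nat) (t : nat -> R) : Prop :=
  t O = a /\ t n = b /\ (forall i, (i < n)%nat -> t i <= t (S i)).

Definition is_curve (D : X -> X -> R) (g : R -> X) (a b : R) : Prop :=
  a <= b /\
  forall t, a <= t <= b -> forall e, 0 < e -> exists eta, 0 < eta /\
    forall s, a <= s <= b -> Rabs (s - t) < eta -> D (g s) (g t) < e.

Definition curve_length (D : X -> X -> R) (g : R -> X) (a b : R) : Rbar :=
  Lub_Rbar (fun s => exists n t, is_partition a b n t /\
     s = sumlt (fun i => D (g (t i)) (g (t (S i)))) n).

Definition rectifiable (D : X -> X -> R) (g : R -> X) (a b : R) : Prop :=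
  is_finite (curve_length D g a b).

(** Line integral  \int_g rho ds  (ds = D-arclength), defined as the
    (lower Darboux-)Riemann-Stieltjes integral of rho o g with respect to the
    arclength function of g: sup over partitions of
      sum_i (inf_{[t_i,t_{i+1}]} rho o g) * l_D(g|[t_i,t_{i+1}]).
    For nonnegative continuous rho and rectifiable g this is the usual
    arclength integral. *)
Definition inf_on (rho : X -> R) (g : R -> X) (u v : R) : R :=
  real (Glb_Rbar (fun r => exists s, u <= s <= v /\ r = rho (g s))).

Definition line_integral (D : X -> X -> R) (rho : X -> R) (g : R -> X)
  (a b : R) : Rbar :=
  Lub_Rbar (fun s => exists n t, is_partition a b n t /\
     s = sumlt (fun i => inf_on rho g (t i) (t (S i)) *
                         real (curve_length D g (t i) (t (S i)))) n).

Definition rho_eps (d : X -> X -> R) (p : X) (eps : R) (z : X) : R :=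
  exp (- eps * d p z).

Definition dist_eps (d : X -> X -> R) (p : X) (eps : R) (x y : X) : R :=
  real (Glb_Rbar (fun I => exists a b g, is_curve d g a b /\
     rectifiable d g a b /\ g a = x /\ g b = y /\
     line_integral d (rho_eps d p eps) g a b = Finite I)).

Definition is_geodesic (D : X -> X -> R) (g : R -> X) (x y : X) : Prop :=
  g 0 = x /\ g (D x y) = y /\
  forall s t, 0 <= s <= D x y -> 0 <= t <= D x y -> D (g s) (g t) = Rabs (s - t).

Definition is_ray (D : X -> X -> R) (g : R -> X) (o : X) : Prop :=
  g 0 = o /\ forall s t, 0 <= s -> 0 <= t -> D (g s) (g t) = Rabs (s - t).

Definition gromov_product (D : X -> X -> R) (p x y : X) : R :=
  (D p x + D p y - D x y) / 2.

Definition closed_ball_compact (D : X -> X -> R) (x : X) (r : R) : Prop :=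
  forall u : nat -> X, (forall n, D x (u n) <= r) ->
  exists (phi : nat -> nat) (z : X),
    (forall n, (phi n < phi (S n))%nat) /\ D x z <= r /\
    is_lim_seq (fun n => D (u (phi n)) z) 0.

Definition proper_space (D : X -> X -> R) : Prop :=
  forall x r, closed_ball_compact D x r.

Definition unbounded_space (D : X -> X -> R) : Prop :=
  forall x K, exists y, D x y > K.

Definition geodesic_space (D : X -> X -> R) : Prop :=
  forall x y, exists g, is_geodesic D g x y.

Definition gromov_hyperbolic (D : X -> X -> R) (delta : R) : Prop :=
  is_metric D /\ unbounded_space D /\ proper_space D /\ geodesic_space D /\
  forall x y z w, gromov_product D w x z >=
     Rmin (gromov_product D w x y) (gromov_product D w y z) - delta.

Definition roughly_starlike (D : X -> X -> R) (M : R) : Prop :=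
  exists o, forall x, exists g, is_ray D g o /\
    Rbar_le (Glb_Rbar (fun r => exists t, 0 <= t /\ r = D x (g t))) (Finite M).

(** Cauchy sequences; points of the metric boundary (closure of X in its
    completion, minus X) are represented by Cauchy sequences in X that do
    not converge in X. *)
Definition cauchy_seq (D : X -> X -> R) (u : nat -> X) : Prop :=
  forall e, 0 < e -> exists N, forall n m, (N <= n)%nat -> (N <= m)%nat ->
    D (u n) (u m) < e.

Definition converges_in (D : X -> X -> R) (u : nat -> X) : Prop :=
  exists z, is_lim_seq (fun n => D (u n) z) 0.

Definition boundary_seq (D : X -> X -> R) (xi : nat -> X) : Prop :=
  cauchy_seq D xi /\ ~ converges_in D xi.

Definition dist_to_bpt (D : X -> X -> R) (z : X) (xi : nat -> X) : R :=
  real (Lim_seq (fun m => D z (xi m))).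

Definition dist_to_boundary (D : X -> X -> R) (z : X) : Rbar :=
  Glb_Rbar (fun r => exists xi, boundary_seq D xi /\ r = dist_to_bpt D z xi).

Definition gromov_seq (d : X -> X -> R) (p : X) (u : nat -> X) : Prop :=
  forall K, exists N, forall n m, (N <= n)%nat -> (N <= m)%nat ->
    gromov_product d p (u n) (u m) >= K.

Definition GH_theorem (d de : X -> X -> R) : Prop :=
  exists A, 0 < A /\ forall x y g, is_geodesic d g x y ->
    Rbar_le (curve_length de g 0 (d x y)) (Finite (A * de x y)).

Definition GH_gromov_seq (d de : X -> X -> R) (p : X) : Prop :=
  forall u, gromov_seq d p u -> exists C, 1 <= C /\
    forall n m g, is_geodesic d g (u n) (u m) ->
      Rbar_le (curve_length de g 0 (d (u n) (u m))) (Finite (C * de (u n) (u m))).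

Definition GH_boundary_points (d de : X -> X -> R) : Prop :=
  forall xi, boundary_seq de xi ->
  forall u : nat -> X, is_lim_seq (fun n => dist_to_bpt de (u n) xi) 0 ->
  exists C, 1 <= C /\
    forall n m g, is_geodesic d g (u n) (u m) ->
      Rbar_le (curve_length de g 0 (d (u n) (u m))) (Finite (C * de (u n) (u m))).

(** The canonical map Phi : [gamma] |-> lim_de gamma(k) is bijective
    (rays are based at p; [gamma] = [gamma'] iff sup_t d(gamma t, gamma' t) < oo;
    boundary points are equal iff representing Cauchy sequences are
    de-asymptotic). *)
Definition Phi_bijective (d de : X -> X -> R) (p : X) : Prop :=
  (forall g g', is_ray d g p -> is_ray d g' p ->
     is_lim_seq (fun k => de (g (INR k)) (g' (INR k))) 0 ->
     exists C, forall t, 0 <= t -> d (g t) (g' t) <= C) /\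
  (forall xi, boundary_seq de xi ->
     exists g, is_ray d g p /\
       is_lim_seq (fun k => dist_to_bpt de (g (INR k)) xi) 0).

Definition uniform_curve (D : X -> X -> R) (A : R) (g : R -> X) (a b : R) : Prop :=
  is_curve D g a b /\
  Rbar_le (curve_length D g a b) (Finite (A * D (g a) (g b))) /\
  forall t, a <= t <= b ->
    Rbar_le (Rbar_min (curve_length D g a t) (curve_length D g t b))
            (Rbar_mult (Finite A) (dist_to_boundary D (g t))).

Definition noncomplete (D : X -> X -> R) : Prop := exists xi, boundary_seq D xi.

Definition locally_compact (D : X -> X -> R) : Prop :=
  forall x, exists r, 0 < r /\ closed_ball_compact D x r.

Definition uniform_space (D : X -> X -> R) : Prop :=
  noncomplete D /\ locally_compact D /\
  exists A, 0 < A /\ forall x y, exists g a b,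
    g a = x /\ g b = y /\ uniform_curve D A g a b.

End Defs.

(* Main.v *)
(** On a geodesic [x,y] the triangle inequality alone gives
    d(p, w) >= (x|y)_p + |w - w0|, where w0 is the point at distance
    d(p,x) - (x|y)_p from x, so that the d_eps-length of [x,y] is at most
    (2/eps) exp(-eps (x|y)_p); hyperbolicity gives d(p, w0) <= (x|y)_p + 2 delta,
    hence a matching lower bound once d(x,y) >= 1. Thus the Gehring-Hayman theorem
    amounts to d_eps(x,y) >= c exp(-eps (x|y)_p) for all x, y with d(x,y) > 1.

    (3) => (1) is immediate. (1) => (2): a Gromov sequence converges to a metric
    boundary point, and conversely (1) turns d_eps-convergence into growth of the
    Gromov products. (2) => (3): pairs violating the bound ever more badly
    accumulate at two points of the Gromov boundary with equal images under Phi,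
    hence at one point, and interleaving them contradicts the property for Gromov
    sequences. (3) => (4): geodesics are uniform curves, since the d_eps-distance
    from z to the boundary is at least rho(z) / (e eps).

    (4) => (3): by rough starlikeness the distance from z to the boundary is at
    most C rho(z). Along a uniform curve choose points a_0, ..., a_{n+1} at mutual
    d-distance comparable to 1; the d_eps-lengths of the initial pieces of the
    chain (up to the middle) and of its final pieces grow geometrically and
    dominate rho(a_k). Geometric growth beats the additive error of the four-point
    inequality, and exp(-eps (x|y)_p) is bounded by the total length of the chain. *)

Require Import Defs.
From Stdlib Require Import Reals Lra Lia Psatz Wf_nat Classical IndefiniteDescription.
From Coquelicot Require Import Coquelicot.
Open Scope R_scope.

(** * Suprema and infima in the extended reals *)

Lemma Lub_Rbar_ub (E : R -> Prop) (x : R) : E x -> Rbar_le x (Lub_Rbar E).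
Proof. intros H. apply (proj1 (Lub_Rbar_correct E)). exact H. Qed.

Lemma Lub_Rbar_least (E : R -> Prop) (b : Rbar) :
  (forall x, E x -> Rbar_le x b) -> Rbar_le (Lub_Rbar E) b.
Proof. intros H. apply (proj2 (Lub_Rbar_correct E)). exact H. Qed.

Lemma Glb_Rbar_finite (E : R -> Prop) (m x : R) :
  (forall y, E y -> m <= y) -> E x -> is_finite (Glb_Rbar E).
Proof.
  intros Hm Hx. destruct (Glb_Rbar_correct E) as [H1 H2].
  specialize (H1 x Hx). assert (H3 : Rbar_le m (Glb_Rbar E)) by (apply H2; exact Hm).
  destruct (Glb_Rbar E); simpl in *; try tauto. reflexivity.
Qed.

Lemma Glb_Rbar_lb (E : R -> Prop) (m x : R) :
  (forall y, E y -> m <= y) -> E x -> real (Glb_Rbar E) <= x.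
Proof.
  intros Hm Hx. pose proof (Glb_Rbar_finite E m x Hm Hx) as Hf.
  pose proof (proj1 (Glb_Rbar_correct E) x Hx) as H. rewrite <- Hf in H. exact H.
Qed.

Lemma Glb_Rbar_greatest (E : R -> Prop) (m x : R) :
  (forall y, E y -> m <= y) -> E x -> m <= real (Glb_Rbar E).
Proof.
  intros Hm Hx. pose proof (Glb_Rbar_finite E m x Hm Hx) as Hf.
  assert (H : Rbar_le m (Glb_Rbar E)) by (apply Glb_Rbar_correct; exact Hm).
  rewrite <- Hf in H. exact H.
Qed.

Lemma Rbar_between_finite (x : Rbar) (a b : R) :
  Rbar_le a x -> Rbar_le x b -> is_finite x.
Proof. destruct x; simpl; try tauto. intros; reflexivity. Qed.

Lemma real_Rbar_le (x : Rbar) (a b : R) :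
  Rbar_le a x -> Rbar_le x b -> a <= real x <= b.
Proof. destruct x; simpl; tauto. Qed.

(** * Finite sums and partitions of intervals *)

Section Sums.

Lemma sumlt_ext (f f' : nat -> R) n :
  (forall i, (i < n)%nat -> f i = f' i) -> sumlt f n = sumlt f' n.
Proof. induction n; simpl; intros H; [easy|]. rewrite IHn, H; auto. Qed.

Lemma sumlt_le (f f' : nat -> R) n :
  (forall i, (i < n)%nat -> f i <= f' i) -> sumlt f n <= sumlt f' n.
Proof.
  induction n; simpl; intros H; [lra|].
  apply Rplus_le_compat; auto.
Qed.

Lemma sumlt_plus (f f' : nat -> R) n :
  sumlt (fun i => f i + f' i) n = sumlt f n + sumlt f' n.
Proof. induction n; simpl; [lra|]. rewrite IHn; lra. Qed.

Lemma sumlt_telescope (f : nat -> R) n :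
  sumlt (fun i => f (S i) - f i) n = f n - f O.
Proof. induction n; simpl; [lra|]. rewrite IHn; lra. Qed.

Lemma sumlt_cat (f : nat -> R) n m :
  sumlt f (n + m) = sumlt f n + sumlt (fun i => f (n + i)%nat) m.
Proof.
  induction m; simpl.
  - rewrite Nat.add_0_r; lra.
  - rewrite Nat.add_succ_r; simpl. rewrite IHm; lra.
Qed.

Lemma sumlt_first (f : nat -> R) n :
  sumlt f (S n) = f O + sumlt (fun i => f (S i)) n.
Proof. change (S n) with (1 + n)%nat. rewrite sumlt_cat. simpl. lra. Qed.

Lemma sumlt_rev (f : nat -> R) n :
  sumlt f n = sumlt (fun i => f (n - S i)%nat) n.
Proof.
  induction n; [easy|].
  rewrite (sumlt_first (fun i => f (S n - S i)%nat)).
  simpl. rewrite IHn, Nat.sub_0_r. simpl. lra.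
Qed.

Lemma partition_le a b n t : is_partition a b n t ->
  forall i j, (i <= j)%nat -> (j <= n)%nat -> t i <= t j.
Proof.
  intros (_ & _ & H) i j Hij. induction Hij; intros Hn; [lra|].
  apply Rle_trans with (t m); [apply IHHij; lia|apply H; lia].
Qed.

Lemma partition_bounds a b n t : is_partition a b n t ->
  forall i, (i <= n)%nat -> a <= t i <= b.
Proof.
  intros H i Hi. destruct H as (Ha & Hb & Hm). rewrite <- Ha, <- Hb.
  split; eapply partition_le; try eassumption; try lia; repeat split; eauto.
Qed.

Lemma partition_of_2 a b : a <= b ->
  is_partition a b 1 (fun i => match i with O => a | _ => b end).
Proof.
  intros H. repeat split. intros i Hi. replace i with O by lia. exact H.
Qed.

Lemma partition_of_3 a b c : a <= b -> b <= c ->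
  is_partition a c 2 (fun i => match i with O => a | S O => b | _ => c end).
Proof.
  intros H1 H2. repeat split. intros i Hi.
  destruct i as [|[|i]]; [exact H1|exact H2|lia].
Qed.

(** Padding a partition of the inner interval with the two outer endpoints is what makes length
    monotone under inclusion of intervals. *)
Lemma partition_extend a u v b n t : a <= u -> v <= b ->
  is_partition u v n t ->
  is_partition a b (S (S n))
    (fun i => match i with O => a | S j => if Nat.leb j n then t j else b end).
Proof.
  intros Hau Hvb (H0 & Hn & H). repeat split.
  - rewrite (proj2 (Nat.leb_gt (S n) n)); [reflexivity|lia].
  - intros i Hi. destruct i as [|i].
    + simpl. lra.
    + rewrite (proj2 (Nat.leb_le i n)); [|lia].
      destruct (Nat.leb_spec (S i) n).
      * apply H; lia.
      * replace i with n by lia. lra.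
Qed.

(** Clamping at [b], instead of inserting [b], keeps the number of steps; a step beyond [b] merely
    degenerates. Together with [partition_max] this allows a term by term comparison of a sum over
    [a,c] with sums over [a,b] and [b,c]. *)
Lemma partition_min a b c n t : a <= b -> b <= c ->
  is_partition a c n t -> is_partition a b n (fun i => Rmin (t i) b).
Proof.
  intros Hab Hbc (H0 & Hn & H). repeat split.
  - rewrite H0. apply Rmin_left; lra.
  - rewrite Hn. apply Rmin_right; lra.
  - intros i Hi. apply Rle_min_compat_r. auto.
Qed.

Lemma partition_max a b c n t : a <= b -> b <= c ->
  is_partition a c n t -> is_partition b c n (fun i => Rmax (t i) b).
Proof.
  intros Hab Hbc (H0 & Hn & H). repeat split.
  - rewrite H0. apply Rmax_right; lra.
  - rewrite Hn. apply Rmax_left; lra.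
  - intros i Hi. apply Rle_max_compat_r. auto.
Qed.

Lemma partition_shift a b h n t :
  is_partition a b n t -> is_partition (a + h) (b + h) n (fun i => t i + h).
Proof.
  intros (H0 & Hn & H). repeat split; [rewrite H0|rewrite Hn|]; trivial.
  intros i Hi. specialize (H i Hi). lra.
Qed.

Lemma partition_rev a b n t :
  is_partition a b n t ->
  is_partition a b n (fun i => a + b - t (n - i)%nat).
Proof.
  intros (H0 & Hn & H). repeat split.
  - rewrite Nat.sub_0_r, Hn; lra.
  - rewrite Nat.sub_diag, H0; lra.
  - intros i Hi. assert (Hs : (n - i = S (n - S i))%nat) by lia.
    rewrite Hs. assert (t (n - S i)%nat <= t (S (n - S i))) by (apply H; lia). lra.
Qed.

End Sums.

(** * Lengths and line integrals *)

Section Length.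
Context {X : Type} (D : X -> X -> R).
Hypothesis D_nonneg : forall x y, 0 <= D x y.

Lemma curve_length_ge_sum g a b n t : is_partition a b n t ->
  Rbar_le (sumlt (fun i => D (g (t i)) (g (t (S i)))) n) (curve_length D g a b).
Proof. intros H. apply Lub_Rbar_ub. exists n, t. auto. Qed.

Lemma curve_length_ge_dist g a b : a <= b ->
  Rbar_le (D (g a) (g b)) (curve_length D g a b).
Proof.
  intros H. pose proof (curve_length_ge_sum g _ _ _ _ (partition_of_2 a b H)) as H1.
  simpl in H1. rewrite Rplus_0_l in H1. exact H1.
Qed.

Lemma curve_length_ge_dist2 g a b c : a <= b -> b <= c ->
  Rbar_le (D (g a) (g b) + D (g b) (g c)) (curve_length D g a c).
Proof.
  intros H H'.
  pose proof (curve_length_ge_sum g _ _ _ _ (partition_of_3 a b c H H')) as H1.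
  simpl in H1. rewrite Rplus_0_l in H1. exact H1.
Qed.

Lemma curve_length_nonneg g a b : a <= b -> Rbar_le 0 (curve_length D g a b).
Proof.
  intros H. eapply Rbar_le_trans; [|apply curve_length_ge_dist, H]. apply D_nonneg.
Qed.

Lemma curve_length_real_nonneg g a b : a <= b -> 0 <= real (curve_length D g a b).
Proof.
  intros H. pose proof (curve_length_nonneg g a b H).
  destruct (curve_length D g a b); simpl in *; lra.
Qed.

Lemma curve_length_sub g a u v b : a <= u -> v <= b ->
  Rbar_le (curve_length D g u v) (curve_length D g a b).
Proof.
  intros Hau Hvb. apply Lub_Rbar_least. intros x (n & t & Ht & ->).
  eapply Rbar_le_trans;
    [|apply curve_length_ge_sum, (partition_extend a u v b n t Hau Hvb Ht)].
  cbv beta. rewrite sumlt_first. simpl sumlt at 2. simpl.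
  match goal with |- _ <= ?A + (?B + ?C) =>
    replace (sumlt (fun i => D (g (t i)) (g (t (S i)))) n) with B;
    [assert (0 <= A) by apply D_nonneg; assert (0 <= C) by apply D_nonneg; lra|] end.
  apply sumlt_ext. intros i Hi.
  rewrite (proj2 (Nat.leb_le i n)) by lia.
  destruct n; [lia|]. rewrite (proj2 (Nat.leb_le i n)) by lia. reflexivity.
Qed.

Lemma rectifiable_sub g a u v b : a <= u -> u <= v -> v <= b ->
  rectifiable D g a b -> rectifiable D g u v.
Proof.
  intros Hau Huv Hvb Hr. unfold rectifiable in *.
  apply (Rbar_between_finite _ 0 (real (curve_length D g a b))).
  - apply curve_length_nonneg, Huv.
  - rewrite Hr. apply curve_length_sub; assumption.
Qed.

Lemma curve_length_ext g g' a b :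
  (forall s, a <= s <= b -> g s = g' s) ->
  curve_length D g a b = curve_length D g' a b.
Proof.
  intros H. apply Lub_Rbar_eqset. intros x.
  assert (Hs : forall n t, is_partition a b n t ->
    sumlt (fun i => D (g (t i)) (g (t (S i)))) n =
    sumlt (fun i => D (g' (t i)) (g' (t (S i)))) n).
  { intros n t Ht. apply sumlt_ext. intros i Hi.
    rewrite !H; trivial; eapply partition_bounds; eauto; lia. }
  split; intros (n & t & Ht & ->); exists n, t; split; auto; symmetry; auto.
Qed.

Lemma curve_length_shift g h a b :
  curve_length D (fun s => g (s + h)) a b = curve_length D g (a + h) (b + h).
Proof.
  apply Lub_Rbar_eqset. intros x; split; intros (n & t & Ht & ->).
  - exists n, (fun i => t i + h). split; [apply partition_shift, Ht|reflexivity].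
  - exists n, (fun i => t i + - h). split.
    + replace a with (a + h + - h) by ring. replace b with (b + h + - h) by ring.
      apply partition_shift, Ht.
    + apply sumlt_ext. intros i _.
      replace (t i + - h + h) with (t i) by ring.
      replace (t (S i) + - h + h) with (t (S i)) by ring. reflexivity.
Qed.

Lemma curve_length_rev_le (D_sym : forall x y, D x y = D y x) g a b k :
  Rbar_le (curve_length D (fun s => g (k - s)) a b) (curve_length D g (k - b) (k - a)).
Proof.
  apply Lub_Rbar_least. intros x (n & t & Ht & ->).
  pose proof (partition_shift _ _ (k - a - b) _ _ (partition_rev a b n t Ht)) as Hp.
  replace (a + (k - a - b)) with (k - b) in Hp by ring.
  replace (b + (k - a - b)) with (k - a) in Hp by ring.
  eapply Rbar_le_trans; [|apply curve_length_ge_sum, Hp].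
  rewrite sumlt_rev. apply Req_le, sumlt_ext. intros i Hi. cbv beta.
  rewrite D_sym. replace (S (n - S i)) with (n - i)%nat by lia.
  f_equal; f_equal; ring.
Qed.

(** Reversal is an involution, so the one-sided estimate applied to the reversed curve gives the
    opposite inequality. *)
Lemma curve_length_rev (D_sym : forall x y, D x y = D y x) g a b k :
  curve_length D (fun s => g (k - s)) a b = curve_length D g (k - b) (k - a).
Proof.
  apply Rbar_le_antisym; [apply curve_length_rev_le, D_sym|].
  pose proof (curve_length_rev_le D_sym (fun s => g (k - s)) (k - b) (k - a) k) as H.
  replace (k - (k - a)) with a in H by ring.
  replace (k - (k - b)) with b in H by ring.
  rewrite <- (curve_length_ext g) in H; [exact H|].
  intros s _. f_equal. ring.
Qed.

(** A step on one side of [b] leaves a degenerate clamped step on the other side; the triangle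
    inequality enters for a step straddling [b]. *)
Lemma dist_split_at (D_refl : forall x, D x x = 0)
  (D_tri : forall x y z, D x z <= D x y + D y z) g u v b : u <= v ->
  D (g u) (g v) <= D (g (Rmin u b)) (g (Rmin v b)) + D (g (Rmax u b)) (g (Rmax v b)).
Proof.
  intros Huv. destruct (Rle_dec v b) as [Hv|Hv]; [|destruct (Rle_dec b u) as [Hu|Hu]].
  - rewrite (Rmin_left u), (Rmin_left v), (Rmax_right u), (Rmax_right v) by lra.
    rewrite D_refl. lra.
  - rewrite (Rmin_right u), (Rmin_right v), (Rmax_left u), (Rmax_left v) by lra.
    rewrite D_refl. lra.
  - rewrite (Rmin_left u), (Rmin_right v), (Rmax_right u), (Rmax_left v) by lra.
    apply D_tri.
Qed.

(** Stated with real upper bounds, so that no sum of possibly infinite lengths has to be formed. *)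
Lemma curve_length_cat (D_refl : forall x, D x x = 0)
  (D_tri : forall x y z, D x z <= D x y + D y z) g a b c L1 L2 :
  a <= b -> b <= c ->
  Rbar_le (curve_length D g a b) (Finite L1) ->
  Rbar_le (curve_length D g b c) (Finite L2) ->
  Rbar_le (curve_length D g a c) (Finite (L1 + L2)).
Proof.
  intros Hab Hbc H1 H2. apply Lub_Rbar_least. intros x (n & t & Ht & ->).
  pose proof (Rbar_le_trans _ _ _
    (curve_length_ge_sum g _ _ _ _ (partition_min a b c n t Hab Hbc Ht)) H1) as G1.
  pose proof (Rbar_le_trans _ _ _
    (curve_length_ge_sum g _ _ _ _ (partition_max a b c n t Hab Hbc Ht)) H2) as G2.
  simpl in *.
  eapply Rle_trans; [|apply Rplus_le_compat; [exact G1|exact G2]].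
  rewrite <- sumlt_plus. apply sumlt_le. intros i Hi.
  apply (dist_split_at D_refl D_tri). apply Ht, Hi.
Qed.

End Length.

Section LineIntegral.
Context {X : Type} (D : X -> X -> R) (rho : X -> R).
Hypothesis D_nonneg : forall x y, 0 <= D x y.
Hypothesis D_refl : forall x, D x x = 0.
Hypothesis D_sym : forall x y, D x y = D y x.
Hypothesis D_tri : forall x y z, D x z <= D x y + D y z.
Hypothesis rho_nonneg : forall x, 0 <= rho x.

Lemma inf_on_ge g u v m : u <= v ->
  (forall s, u <= s <= v -> m <= rho (g s)) -> m <= inf_on rho g u v.
Proof.
  intros Huv H. apply (Glb_Rbar_greatest _ m (rho (g u))).
  - intros y (s & Hs & ->). auto.
  - exists u. split; [lra|reflexivity].
Qed.

Lemma inf_on_le g u v s : u <= s <= v -> inf_on rho g u v <= rho (g s).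
Proof.
  intros Hs. apply (Glb_Rbar_lb _ 0).
  - intros y (s' & Hs' & ->). auto.
  - exists s. split; auto.
Qed.

Lemma inf_on_nonneg g u v : u <= v -> 0 <= inf_on rho g u v.
Proof. intros H. apply inf_on_ge; auto. Qed.

Lemma inf_on_anti g u v u' v' : u <= u' -> u' <= v' -> v' <= v ->
  inf_on rho g u v <= inf_on rho g u' v'.
Proof. intros. apply inf_on_ge; [lra|]. intros s Hs. apply inf_on_le. lra. Qed.

Lemma inf_on_ext g g' u v : (forall s, u <= s <= v -> g s = g' s) ->
  inf_on rho g u v = inf_on rho g' u v.
Proof.
  intros H. unfold inf_on. f_equal. apply Glb_Rbar_eqset.
  intros x; split; intros (s & Hs & ->); exists s; rewrite H; auto.
Qed.

Lemma inf_on_shift g h u v :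
  inf_on rho (fun s => g (s + h)) u v = inf_on rho g (u + h) (v + h).
Proof.
  unfold inf_on. f_equal. apply Glb_Rbar_eqset.
  intros x; split; intros (s & Hs & ->).
  - exists (s + h). split; [lra|reflexivity].
  - exists (s - h). split; [lra|]. do 2 f_equal. ring.
Qed.

Lemma inf_on_rev g k u v :
  inf_on rho (fun s => g (k - s)) u v = inf_on rho g (k - v) (k - u).
Proof.
  unfold inf_on. f_equal. apply Glb_Rbar_eqset.
  intros x; split; intros (s & Hs & ->).
  - exists (k - s). split; [lra|reflexivity].
  - exists (k - s). split; [lra|]. do 2 f_equal. ring.
Qed.

Lemma line_integral_ge_sum g a b n t : is_partition a b n t ->
  Rbar_le (sumlt (fun i => inf_on rho g (t i) (t (S i)) *
     real (curve_length D g (t i) (t (S i)))) n) (line_integral D rho g a b).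
Proof. intros H. apply Lub_Rbar_ub. exists n, t. auto. Qed.

Lemma line_integral_nonneg g a b : a <= b -> Rbar_le 0 (line_integral D rho g a b).
Proof.
  intros H. eapply Rbar_le_trans;
    [|apply line_integral_ge_sum, (partition_of_2 a b H)].
  simpl. rewrite Rplus_0_l. apply Rmult_le_pos.
  - apply inf_on_nonneg, H.
  - apply curve_length_real_nonneg; trivial.
Qed.

Lemma line_integral_ext g g' a b :
  (forall s, a <= s <= b -> g s = g' s) ->
  line_integral D rho g a b = line_integral D rho g' a b.
Proof.
  intros H. apply Lub_Rbar_eqset. intros x.
  assert (Hs : forall n t, is_partition a b n t ->
    sumlt (fun i => inf_on rho g (t i) (t (S i)) * real (curve_length D g (t i) (t (S i)))) n =
    sumlt (fun i => inf_on rho g' (t i) (t (S i)) * real (curve_length D g' (t i) (t (S i)))) n).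
  { intros n t Ht. apply sumlt_ext. intros i Hi.
    assert (G : forall s, t i <= s <= t (S i) -> g s = g' s).
    { intros s Hs. apply H.
      pose proof (partition_bounds _ _ _ _ Ht i ltac:(lia)).
      pose proof (partition_bounds _ _ _ _ Ht (S i) ltac:(lia)). lra. }
    rewrite (inf_on_ext g g'), (curve_length_ext D g g'); auto. }
  split; intros (n & t & Ht & ->); exists n, t; split; auto; symmetry; auto.
Qed.

Lemma line_integral_shift g h a b :
  line_integral D rho (fun s => g (s + h)) a b = line_integral D rho g (a + h) (b + h).
Proof.
  apply Lub_Rbar_eqset. intros x; split; intros (n & t & Ht & ->).
  - exists n, (fun i => t i + h). split; [apply partition_shift, Ht|].
    apply sumlt_ext. intros i _. rewrite inf_on_shift, curve_length_shift. reflexivity.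
  - exists n, (fun i => t i + - h). split.
    + replace a with (a + h + - h) by ring. replace b with (b + h + - h) by ring.
      apply partition_shift, Ht.
    + apply sumlt_ext. intros i _. rewrite inf_on_shift, curve_length_shift.
      replace (t i + - h + h) with (t i) by ring.
      replace (t (S i) + - h + h) with (t (S i)) by ring. reflexivity.
Qed.

Lemma line_integral_rev_le g a b :
  Rbar_le (line_integral D rho (fun s => g (a + b - s)) a b) (line_integral D rho g a b).
Proof.
  apply Lub_Rbar_least. intros x (n & t & Ht & ->).
  eapply Rbar_le_trans; [|apply line_integral_ge_sum, (partition_rev a b n t Ht)].
  rewrite sumlt_rev. apply Req_le, sumlt_ext. intros i Hi. cbv beta.
  rewrite inf_on_rev, curve_length_rev by assumption.
  replace (S (n - S i)) with (n - i)%nat by lia. reflexivity.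
Qed.

Lemma line_integral_rev g a b :
  line_integral D rho (fun s => g (a + b - s)) a b = line_integral D rho g a b.
Proof.
  apply Rbar_le_antisym; [apply line_integral_rev_le|].
  pose proof (line_integral_rev_le (fun s => g (a + b - s)) a b) as H.
  rewrite <- (line_integral_ext g) in H; [exact H|].
  intros s _. f_equal. ring.
Qed.

(** As for lengths, every step is split at [b]; the infimum of [rho] over a straddling step is at
    most its infimum over either half. *)
Lemma line_integral_cat g a b c I1 I2 :
  a <= b -> b <= c -> rectifiable D g a b -> rectifiable D g b c ->
  Rbar_le (line_integral D rho g a b) (Finite I1) ->
  Rbar_le (line_integral D rho g b c) (Finite I2) ->
  Rbar_le (line_integral D rho g a c) (Finite (I1 + I2)).
Proof.
  intros Hab Hbc R1 R2 H1 H2. apply Lub_Rbar_least. intros x (n & t & Ht & ->).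
  pose proof (Rbar_le_trans _ _ _
    (line_integral_ge_sum g _ _ _ _ (partition_min a b c n t Hab Hbc Ht)) H1) as G1.
  pose proof (Rbar_le_trans _ _ _
    (line_integral_ge_sum g _ _ _ _ (partition_max a b c n t Hab Hbc Ht)) H2) as G2.
  simpl in *.
  eapply Rle_trans; [|apply Rplus_le_compat; [exact G1|exact G2]].
  rewrite <- sumlt_plus. apply sumlt_le. intros i Hi.
  pose proof (partition_bounds _ _ _ _ Ht i ltac:(lia)) as B1.
  pose proof (partition_bounds _ _ _ _ Ht (S i) ltac:(lia)) as B2.
  assert (Huv : t i <= t (S i)) by (apply Ht, Hi).
  set (u := t i) in *. set (v := t (S i)) in *. clearbody u v.
  assert (Hpos : forall r s, r <= s -> 0 <= inf_on rho g r s * real (curve_length D g r s)).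
  { intros r s Hrs. apply Rmult_le_pos; [apply inf_on_nonneg, Hrs|].
    apply curve_length_real_nonneg; trivial. }
  (* A step on one side of [b] produces the degenerate interval [b,b] on the other; its term is
     dropped by nonnegativity. *)
  assert (P := Hpos b b (Rle_refl b)).
  destruct (Rle_dec v b) as [Hv|Hv]; [|destruct (Rle_dec b u) as [Hu|Hu]].
  - rewrite (Rmin_left u), (Rmin_left v), (Rmax_right u), (Rmax_right v) by lra. lra.
  - rewrite (Rmin_right u), (Rmin_right v), (Rmax_left u), (Rmax_left v) by lra. lra.
  - rewrite (Rmin_left u), (Rmin_right v), (Rmax_right u), (Rmax_left v) by lra.
    (* Finiteness matters here, because [real] sends an infinite length to 0. *)
    assert (F1 : rectifiable D g u b)
      by (apply (rectifiable_sub D D_nonneg g a u b b); trivial; lra).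
    assert (F2 : rectifiable D g b v)
      by (apply (rectifiable_sub D D_nonneg g b b v c); trivial; lra).
    assert (L : real (curve_length D g u v) <=
                real (curve_length D g u b) + real (curve_length D g b v)).
    { apply (real_Rbar_le _ 0); [apply curve_length_nonneg; trivial|].
      apply (curve_length_cat D D_refl D_tri g u b v); try lra.
      - rewrite F1; apply Rbar_le_refl.
      - rewrite F2; apply Rbar_le_refl. }
    assert (I0 : 0 <= inf_on rho g u v) by (apply inf_on_nonneg; lra).
    assert (J1 : inf_on rho g u v <= inf_on rho g u b) by (apply inf_on_anti; lra).
    assert (J2 : inf_on rho g u v <= inf_on rho g b v) by (apply inf_on_anti; lra).
    assert (K1 : 0 <= real (curve_length D g u b))
      by (apply curve_length_real_nonneg; trivial; lra).
    assert (K2 : 0 <= real (curve_length D g b v))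
      by (apply curve_length_real_nonneg; trivial; lra).
    nra.
Qed.

End LineIntegral.

(** * Isometric arcs and operations on curves *)

Lemma exp_monotone x y : x <= y -> exp x <= exp y.
Proof. intros [H|H]; [left; apply exp_increasing, H|right; f_equal; exact H]. Qed.

(** The parameter interval is free, unlike in [is_geodesic], so that subarcs of geodesics are
    covered, and also the constant path on [0,0]. *)
Definition isometric_on {X : Type} (D : X -> X -> R) (g : R -> X) (u v : R) : Prop :=
  forall s t, u <= s <= v -> u <= t <= v -> D (g s) (g t) = Rabs (s - t).

Section Curves.
Context {X : Type} (D : X -> X -> R) (HD : is_metric D).

Lemma metric_nonneg x y : 0 <= D x y.
Proof. apply HD. Qed.

Lemma metric_refl x : D x x = 0.
Proof. apply HD. reflexivity. Qed.

Lemma metric_sym x y : D x y = D y x.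
Proof. apply HD. Qed.

Lemma metric_tri x y z : D x z <= D x y + D y z.
Proof. apply HD. Qed.

Definition curve_cat (g1 g2 : R -> X) (b1 a2 : R) (t : R) : X :=
  if Rle_dec t b1 then g1 t else g2 (t + (a2 - b1)).

Lemma curve_cat_left g1 g2 b1 a2 t : t <= b1 -> curve_cat g1 g2 b1 a2 t = g1 t.
Proof. intros H. unfold curve_cat. destruct (Rle_dec t b1); [easy|lra]. Qed.

Lemma curve_cat_right g1 g2 b1 a2 t : g1 b1 = g2 a2 -> b1 <= t ->
  curve_cat g1 g2 b1 a2 t = g2 (t + (a2 - b1)).
Proof.
  intros Hg H. unfold curve_cat. destruct (Rle_dec t b1); [|easy].
  replace t with b1 by lra. rewrite Hg. f_equal. ring.
Qed.

Lemma is_curve_cat g1 g2 a1 b1 a2 b2 : g1 b1 = g2 a2 ->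
  is_curve D g1 a1 b1 -> is_curve D g2 a2 b2 ->
  is_curve D (curve_cat g1 g2 b1 a2) a1 (b1 + (b2 - a2)).
Proof.
  intros Hg [H1 C1] [H2 C2]. split; [lra|]. intros t Ht e He.
  assert (L : exists eta, 0 < eta /\ forall s, a1 <= s <= b1 -> Rabs (s - t) < eta ->
    D (curve_cat g1 g2 b1 a2 s) (curve_cat g1 g2 b1 a2 t) < e).
  { destruct (Rle_dec t b1) as [Hl|Hl].
    - destruct (C1 t ltac:(lra) e He) as (eta & Heta & H). exists eta. split; trivial.
      intros s Hs Hst. rewrite !curve_cat_left by lra. auto.
    (* Here [t] lies strictly to the right of [b1], and with this radius no [s] in the left half is
       close enough to [t]: the condition is void. *)
    - exists (t - b1). split; [lra|]. intros s Hs Hst.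
      apply Rabs_def2 in Hst. lra. }
  assert (R : exists eta, 0 < eta /\ forall s, b1 <= s <= b1 + (b2 - a2) -> Rabs (s - t) < eta ->
    D (curve_cat g1 g2 b1 a2 s) (curve_cat g1 g2 b1 a2 t) < e).
  { destruct (Rle_dec b1 t) as [Hl|Hl].
    - destruct (C2 (t + (a2 - b1)) ltac:(lra) e He) as (eta & Heta & H).
      exists eta. split; trivial.
      intros s Hs Hst. rewrite !curve_cat_right by (trivial; lra). apply H; [lra|].
      replace (s + (a2 - b1) - (t + (a2 - b1))) with (s - t) by ring. exact Hst.
    - exists (b1 - t). split; [lra|]. intros s Hs Hst.
      apply Rabs_def2 in Hst. lra. }
  destruct L as (e1 & P1 & L), R as (e2 & P2 & R).
  exists (Rmin e1 e2). split; [apply Rmin_glb_lt; trivial|].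
  intros s Hs Hst. destruct (Rle_dec s b1).
  - apply L; [lra|]. eapply Rlt_le_trans; [exact Hst|apply Rmin_l].
  - apply R; [lra|]. eapply Rlt_le_trans; [exact Hst|apply Rmin_r].
Qed.

Lemma is_curve_rev g a b :
  is_curve D g a b -> is_curve D (fun s => g (a + b - s)) a b.
Proof.
  intros [H C]. split; trivial. intros t Ht e He.
  destruct (C (a + b - t) ltac:(lra) e He) as (eta & P & Q).
  exists eta. split; trivial. intros s Hs Hst. apply Q; [lra|].
  replace (a + b - s - (a + b - t)) with (- (s - t)) by ring. rewrite Rabs_Ropp. exact Hst.
Qed.

Lemma isometric_on_sub g u v u' v' : u <= u' -> v' <= v ->
  isometric_on D g u v -> isometric_on D g u' v'.
Proof. intros H1 H2 H s t Hs Ht. apply H; lra. Qed.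

Lemma isometric_on_curve g u v : u <= v -> isometric_on D g u v -> is_curve D g u v.
Proof.
  intros Huv H. split; trivial. intros t Ht e He. exists e. split; trivial.
  intros s Hs Hst. rewrite H; trivial.
Qed.

Lemma isometric_on_length g u v : u <= v -> isometric_on D g u v ->
  curve_length D g u v = v - u.
Proof.
  intros Huv H. apply Rbar_le_antisym.
  - apply Lub_Rbar_least. intros x (n & t & Ht & ->).
    rewrite (sumlt_ext _ (fun i => t (S i) - t i)).
    + rewrite sumlt_telescope. destruct Ht as (-> & -> & _). apply Rbar_le_refl.
    + intros i Hi. rewrite H; [|apply (partition_bounds _ _ _ _ Ht); lia..].
      assert (t i <= t (S i)) by (apply Ht, Hi).
      rewrite Rabs_left1 by lra. ring.
  - eapply Rbar_le_trans; [|apply curve_length_ge_dist, Huv].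
    rewrite H by lra. rewrite Rabs_left1 by lra. simpl. lra.
Qed.

(** [T] is the supremum of the times up to which the curve stays in the closed ball of radius [r]
    about [x]. Continuity keeps the curve in the ball at time [T]; were it strictly inside, [T]
    could be increased. *)
Lemma first_exit g a b x r : is_curve D g a b ->
  D x (g a) <= r -> r <= D x (g b) ->
  exists T, a <= T <= b /\ (forall s, a <= s <= T -> D x (g s) <= r) /\ r <= D x (g T).
Proof.
  intros [Hab C] Ha Hb.
  set (E := fun t => a <= t <= b /\ forall s, a <= s <= t -> D x (g s) <= r).
  assert (Ea : E a).
  { split; [lra|]. intros s Hs. replace s with a by lra. exact Ha. }
  destruct (completeness E) as [T [HT1 HT2]].
  { exists b. intros t [Ht _]. lra. }
  { exists a. exact Ea. }
  assert (HaT : a <= T) by (apply HT1, Ea).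
  assert (HTb : T <= b) by (apply HT2; intros t [Ht _]; lra).
  assert (Below : forall s, a <= s < T -> D x (g s) <= r).
  { intros s Hs. destruct (Rle_dec (D x (g s)) r) as [|N]; trivial. exfalso.
    apply (Rlt_not_le T s); [lra|]. apply HT2. intros t [Ht1 Ht2].
    destruct (Rle_dec t s); trivial. exfalso. apply N, Ht2. lra. }
  assert (AtT : D x (g T) <= r).
  { destruct (Rle_dec (D x (g T)) r) as [|N]; trivial. exfalso.
    destruct (Req_dec a T) as [<-|HneT]; [lra|].
    destruct (C T ltac:(lra) (D x (g T) - r) ltac:(lra)) as (eta & P & Q).
    set (s := Rmax a (T - eta / 2)).
    assert (s < T) by (apply Rmax_lub_lt; lra).
    assert (a <= s) by apply Rmax_l. assert (T - eta / 2 <= s) by apply Rmax_r.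
    assert (Hd : D (g s) (g T) < D x (g T) - r).
    { apply Q; [lra|]. rewrite Rabs_left; lra. }
    pose proof (metric_tri x (g s) (g T)). pose proof (Below s ltac:(lra)). lra. }
  exists T. split; [lra|]. split.
  - intros s Hs. destruct (Req_dec s T) as [->|]; [exact AtT|apply Below; lra].
  - destruct (Rle_dec r (D x (g T))) as [|N]; trivial. exfalso.
    destruct (C T ltac:(lra) (r - D x (g T)) ltac:(lra)) as (eta & P & Q).
    assert (HTb' : T < b) by (destruct (Req_dec T b) as [->|]; lra).
    set (s := Rmin b (T + eta / 2)).
    assert (T < s) by (apply Rmin_glb_lt; lra).
    assert (s <= b) by apply Rmin_l. assert (s <= T + eta / 2) by apply Rmin_r.
    apply (Rlt_not_le s T); trivial. apply HT1. split; [lra|].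
    intros w Hw. destruct (Rlt_dec w T); [apply Below; lra|].
    assert (D (g w) (g T) < r - D x (g T)).
    { apply Q; [lra|]. rewrite Rabs_right; lra. }
    pose proof (metric_tri x (g T) (g w)). rewrite (metric_sym (g T)) in *. lra.
Qed.

End Curves.

(** * The uniformized metric *)

Section Uniformization.
Context {X : Type} (d : X -> X -> R) (p : X) (eps : R).
Hypothesis Hd : is_metric d.
Hypothesis Hgeod : geodesic_space d.
Hypothesis Heps : 0 < eps.

Notation rho := (rho_eps d p eps).
Notation de := (dist_eps d p eps).

Lemma rho_pos x : 0 < rho x.
Proof. apply exp_pos. Qed.

Lemma rho_nonneg x : 0 <= rho x.
Proof. apply Rlt_le, rho_pos. Qed.

Lemma rho_le_exp x k : k <= d p x -> rho x <= exp (- eps * k).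
Proof.
  intros H. unfold rho_eps. apply exp_monotone. nra.
Qed.

Lemma rho_ge_exp x k : d p x <= k -> exp (- eps * k) <= rho x.
Proof.
  intros H. unfold rho_eps. apply exp_monotone. nra.
Qed.

Lemma rho_le_1 x : rho x <= 1.
Proof.
  rewrite <- exp_0. replace 0 with (- eps * 0) by ring.
  apply rho_le_exp, metric_nonneg, Hd.
Qed.

(** Harnack inequality: the logarithm of [rho] is [eps]-Lipschitz. *)
Lemma rho_harnack x y : rho x * exp (- eps * d x y) <= rho y.
Proof.
  unfold rho_eps. rewrite <- exp_plus. apply exp_monotone.
  pose proof (metric_tri d Hd p x y). nra.
Qed.

(** The set whose infimum defines [dist_eps], spelled exactly as there, so that facts on [Glb_Rbar]
    apply by conversion. *)
Definition joining_integral (x y : X) (I : R) : Prop :=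
  exists a b g, is_curve d g a b /\ rectifiable d g a b /\ g a = x /\ g b = y /\
     line_integral d rho g a b = Finite I.

Lemma joining_integral_nonneg x y I : joining_integral x y I -> 0 <= I.
Proof.
  intros (a & b & g & [Hab _] & _ & _ & _ & HI).
  pose proof (line_integral_nonneg d rho (metric_nonneg d Hd) rho_nonneg g a b Hab) as H.
  rewrite HI in H. exact H.
Qed.

Lemma geodesic_isometric g x y : is_geodesic d g x y -> isometric_on d g 0 (d x y).
Proof. intros (_ & _ & H). exact H. Qed.

(* F plays the role of a primitive of a function dominating [rho o g]; the
   hypothesis is what the mean value theorem would give. *)
Lemma isometric_joining_integral g u v F : u <= v -> isometric_on d g u v ->
  (forall s t, u <= s -> s <= t -> t <= v ->
     exists c, s <= c <= t /\ rho (g c) * (t - s) <= F t - F s) ->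
  exists I, joining_integral (g u) (g v) I /\ I <= F v - F u.
Proof.
  intros Huv Hg HF.
  assert (Hu : Rbar_le (line_integral d rho g u v) (Finite (F v - F u))).
  { apply Lub_Rbar_least. intros x (n & t & Ht & ->).
    apply Rle_trans with (sumlt (fun i => F (t (S i)) - F (t i)) n).
    - apply sumlt_le. intros i Hi.
      pose proof (partition_bounds _ _ _ _ Ht i ltac:(lia)) as B1.
      pose proof (partition_bounds _ _ _ _ Ht (S i) ltac:(lia)) as B2.
      assert (Hii : t i <= t (S i)) by (apply Ht, Hi).
      destruct (HF (t i) (t (S i))) as (c & Hc & Hle); try lra.
      rewrite (isometric_on_length d g (t i) (t (S i))); trivial;
        [|apply (isometric_on_sub d g u v); trivial; lra].
      simpl. eapply Rle_trans; [|exact Hle].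
      apply Rmult_le_compat_r; [lra|]. apply inf_on_le; trivial. apply rho_nonneg.
    - rewrite (sumlt_telescope (fun i => F (t i))). destruct Ht as (-> & -> & _). lra. }
  pose proof (line_integral_nonneg d rho (metric_nonneg d Hd) rho_nonneg g u v Huv) as Hl.
  exists (real (line_integral d rho g u v)). split.
  - exists u, v, g. repeat split; trivial.
    + apply isometric_on_curve; trivial.
    + unfold rectifiable. rewrite isometric_on_length; trivial. reflexivity.
    + symmetry. apply (Rbar_between_finite _ _ _ Hl Hu).
  - apply (real_Rbar_le _ _ _ Hl Hu).
Qed.

Lemma joining_integral_exists x y : exists I, joining_integral x y I.
Proof.
  destruct (Hgeod x y) as [g Hg].
  destruct (isometric_joining_integral g 0 (d x y) (fun t => t)) as (I & HI & _).
  - apply metric_nonneg, Hd.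
  - apply geodesic_isometric, Hg.
  - intros s t _ Hst _. exists s. split; [lra|]. pose proof (rho_le_1 (g s)). nra.
  - destruct Hg as (<- & H & _). rewrite H in HI. eauto.
Qed.

Lemma de_le_joining x y I : joining_integral x y I -> de x y <= I.
Proof.
  intros H. apply (Glb_Rbar_lb (joining_integral x y) 0); trivial.
  apply joining_integral_nonneg.
Qed.

Lemma de_ge_lower_bound x y m :
  (forall I, joining_integral x y I -> m <= I) -> m <= de x y.
Proof.
  intros H. destruct (joining_integral_exists x y) as [I HI].
  apply (Glb_Rbar_greatest (joining_integral x y) m I); trivial.
Qed.

Lemma de_nonneg x y : 0 <= de x y.
Proof. apply de_ge_lower_bound, joining_integral_nonneg. Qed.

Lemma joining_integral_sym x y I : joining_integral x y I -> joining_integral y x I.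
Proof.
  intros (a & b & g & Hc & Hr & Hx & Hy & HI).
  exists a, b, (fun s => g (a + b - s)). repeat split.
  - apply Hc.
  - apply is_curve_rev, Hc.
  - unfold rectifiable.
    rewrite (curve_length_rev d (metric_sym d Hd)).
    replace (a + b - b) with a by ring. replace (a + b - a) with b by ring. exact Hr.
  - rewrite <- Hy. f_equal. ring.
  - rewrite <- Hx. f_equal. ring.
  - rewrite line_integral_rev; trivial. apply metric_sym, Hd.
Qed.

Lemma de_sym x y : de x y = de y x.
Proof.
  apply Rle_antisym; apply de_ge_lower_bound; intros I HI;
    apply de_le_joining, joining_integral_sym, HI.
Qed.

Lemma joining_integral_cat x y z I J :
  joining_integral x y I -> joining_integral y z J ->
  exists K, joining_integral x z K /\ K <= I + J.
Proof.
  intros (a1 & b1 & g1 & Hc1 & Hr1 & Hx1 & Hy1 & HI1)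
         (a2 & b2 & g2 & Hc2 & Hr2 & Hx2 & Hy2 & HI2).
  assert (Hg : g1 b1 = g2 a2) by congruence.
  set (g := curve_cat g1 g2 b1 a2). set (c := b1 + (b2 - a2)).
  pose proof (proj1 Hc1) as H1. pose proof (proj1 Hc2) as H2.
  assert (Hbc : b1 <= c) by (unfold c; lra).
  assert (E1 : forall s, a1 <= s <= b1 -> g s = g1 s).
  { intros s Hs. apply curve_cat_left. lra. }
  assert (E2 : forall s, b1 <= s <= c -> g s = g2 (s + (a2 - b1))).
  { intros s Hs. apply curve_cat_right; trivial. lra. }
  assert (L1 : curve_length d g a1 b1 = curve_length d g1 a1 b1)
    by (apply curve_length_ext; trivial).
  assert (L2 : curve_length d g b1 c = curve_length d g2 a2 b2).
  { rewrite (curve_length_ext d g _ _ _ E2), curve_length_shift.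
    f_equal; unfold c; ring. }
  assert (I1 : line_integral d rho g a1 b1 = Finite I)
    by (rewrite <- HI1; apply line_integral_ext; trivial).
  assert (I2 : line_integral d rho g b1 c = Finite J).
  { rewrite (line_integral_ext d rho g _ _ _ E2), line_integral_shift, <- HI2.
    f_equal; unfold c; ring. }
  assert (R1 : rectifiable d g a1 b1) by (unfold rectifiable; rewrite L1; trivial).
  assert (R2 : rectifiable d g b1 c) by (unfold rectifiable; rewrite L2; trivial).
  assert (U : Rbar_le (line_integral d rho g a1 c) (Finite (I + J))).
  { apply (line_integral_cat d rho (metric_nonneg d Hd) (metric_refl d Hd)
      (metric_tri d Hd) rho_nonneg g a1 b1 c); trivial.
    - rewrite I1. apply Rbar_le_refl.
    - rewrite I2. apply Rbar_le_refl. }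
  pose proof (line_integral_nonneg d rho (metric_nonneg d Hd) rho_nonneg g a1 c
    ltac:(lra)) as Hl.
  exists (real (line_integral d rho g a1 c)). split; [|apply (real_Rbar_le _ _ _ Hl U)].
  exists a1, c, g. split; [|split; [|split; [|split]]].
  - apply is_curve_cat; trivial.
  - apply (Rbar_between_finite _ 0
      (real (curve_length d g a1 b1) + real (curve_length d g b1 c))).
    + apply curve_length_nonneg; [apply metric_nonneg, Hd|lra].
    + apply (curve_length_cat d (metric_refl d Hd) (metric_tri d Hd) g a1 b1 c); trivial.
      * rewrite R1. apply Rbar_le_refl.
      * rewrite R2. apply Rbar_le_refl.
  - rewrite E1 by lra. exact Hx1.
  - rewrite E2 by lra. rewrite <- Hy2. f_equal. unfold c. ring.
  - symmetry. apply (Rbar_between_finite _ _ _ Hl U).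
Qed.

(** The two infima on the right are handled one after the other: a competitor for the first is fixed
    and subtracted before the second is treated. *)
Lemma de_tri x y z : de x z <= de x y + de y z.
Proof.
  assert (H : de x z - de y z <= de x y); [|lra].
  apply de_ge_lower_bound. intros I HI.
  assert (H : de x z - I <= de y z); [|lra].
  apply de_ge_lower_bound. intros J HJ.
  destruct (joining_integral_cat _ _ _ _ _ HI HJ) as (K & HK & HKle).
  pose proof (de_le_joining _ _ _ HK). lra.
Qed.

Lemma de_refl x : de x x = 0.
Proof.
  apply Rle_antisym; [|apply de_nonneg].
  destruct (isometric_joining_integral (fun _ => x) 0 0 (fun t => t)) as (I & HI & HIle).
  - lra.
  - intros s t Hs Ht. rewrite metric_refl by trivial.
    replace s with 0 by lra. replace t with 0 by lra. rewrite Rminus_0_r, Rabs_R0. easy.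
  - intros s t Hs1 Hst Ht. exists s. split; [lra|].
    replace s with 0 by lra. replace t with 0 by lra. lra.
  - pose proof (de_le_joining _ _ _ HI). lra.
Qed.

Lemma isometric_de_le g u v F s t : isometric_on d g u v ->
  (forall s t, u <= s -> s <= t -> t <= v ->
     exists c, s <= c <= t /\ rho (g c) * (t - s) <= F t - F s) ->
  u <= s -> s <= t -> t <= v -> de (g s) (g t) <= F t - F s.
Proof.
  intros Hg HF Hus Hst Htv.
  destruct (isometric_joining_integral g s t F) as (I & HI & Hle); trivial.
  - apply (isometric_on_sub d g u v); trivial.
  - intros; apply HF; lra.
  - pose proof (de_le_joining _ _ _ HI). lra.
Qed.

(** Each step of a partition is itself an isometric arc, so its [de]-distance is at most the
    increment of [F], and the increments telescope. This bounds the [de]-length without identifying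
    it with the integral of [rho]. *)
Lemma isometric_curve_length_le g u v F : isometric_on d g u v ->
  (forall s t, u <= s -> s <= t -> t <= v ->
     exists c, s <= c <= t /\ rho (g c) * (t - s) <= F t - F s) ->
  Rbar_le (curve_length de g u v) (Finite (F v - F u)).
Proof.
  intros Hg HF. apply Lub_Rbar_least. intros x (n & t & Ht & ->).
  apply Rle_trans with (sumlt (fun i => F (t (S i)) - F (t i)) n).
  - apply sumlt_le. intros i Hi.
    pose proof (partition_bounds _ _ _ _ Ht i ltac:(lia)) as B1.
    pose proof (partition_bounds _ _ _ _ Ht (S i) ltac:(lia)) as B2.
    assert (Hii : t i <= t (S i)) by (apply Ht, Hi).
    apply (isometric_de_le g u v); trivial; lra.
  - rewrite (sumlt_telescope (fun i => F (t i))). destruct Ht as (-> & -> & _). lra.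
Qed.

Lemma de_le_d x y : de x y <= d x y.
Proof.
  destruct (Hgeod x y) as [g Hg]. pose proof (metric_nonneg d Hd x y) as H.
  pose proof (isometric_de_le g 0 (d x y) (fun t => t) 0 (d x y)
    (geodesic_isometric _ _ _ Hg)) as Hle.
  destruct Hg as (G0 & G1 & _). rewrite G0, G1 in Hle.
  cbv beta in Hle. rewrite Rminus_0_r in Hle. apply Hle; try lra.
  intros s t _ Hst _. exists s. split; [lra|]. pose proof (rho_le_1 (g s)). nra.
Qed.

(** Any curve from [x] to [y] reaches distance r = min(1/eps, d(x,y)) from [x]. Up to the first exit
    its length is at least r, and there [rho] is at least rho(x)/e by the Harnack inequality. *)
Lemma de_lower x y : exp (-1) * rho x * Rmin (/ eps) (d x y) <= de x y.
Proof.
  apply de_ge_lower_bound. intros I (a & b & g & Hc & Hr & Hx & Hy & HI).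
  set (r := Rmin (/ eps) (d x y)).
  assert (Hie : 0 < / eps) by (apply Rinv_0_lt_compat, Heps).
  assert (Hr0 : 0 <= r) by (apply Rmin_glb; [lra|apply metric_nonneg, Hd]).
  assert (Hr1 : r <= / eps) by apply Rmin_l.
  destruct (first_exit d Hd g a b x r) as (T & HT & Hin & Hout); trivial.
  { rewrite Hx, metric_refl; trivial. }
  { rewrite Hy. apply Rmin_r. }
  assert (HRT : rectifiable d g a T)
    by (apply (rectifiable_sub d (metric_nonneg d Hd) g a a T b); trivial; lra).
  (* Lower sum for the partition a, T, b; the term over [T,b] is discarded as nonnegative. *)
  pose proof (line_integral_ge_sum d rho g _ _ _ _
    (partition_of_3 a T b ltac:(lra) ltac:(lra))) as H.
  rewrite HI in H. simpl in H. rewrite Rplus_0_l in H.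
  assert (H2 : 0 <= inf_on rho g T b * real (curve_length d g T b)).
  { apply Rmult_le_pos.
    - apply inf_on_nonneg; [apply rho_nonneg|lra].
    - apply curve_length_real_nonneg; [apply metric_nonneg, Hd|lra]. }
  assert (H1 : exp (-1) * rho x <= inf_on rho g a T).
  { apply inf_on_ge; [lra|]. intros s Hs. eapply Rle_trans; [|apply (rho_harnack x)].
    rewrite Rmult_comm. apply Rmult_le_compat_l; [apply rho_nonneg|].
    apply exp_monotone. specialize (Hin s Hs).
    assert (eps * d x (g s) <= eps * / eps) by (apply Rmult_le_compat_l; lra).
    rewrite Rinv_r in * by lra. lra. }
  assert (H3 : r <= real (curve_length d g a T)).
  { pose proof (curve_length_ge_dist d g a T ltac:(lra)) as Hl. rewrite <- HRT in Hl.
    simpl in Hl. rewrite Hx in Hl. lra. }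
  assert (exp (-1) * rho x * r <= inf_on rho g a T * real (curve_length d g a T)).
  { apply Rmult_le_compat; trivial.
    apply Rmult_le_pos; [apply Rlt_le, exp_pos|apply rho_nonneg]. }
  lra.
Qed.

End Uniformization.

(** * Elementary facts on sequences *)

Lemma lim_seq_0_iff (u : nat -> R) :
  is_lim_seq u 0 <->
  forall e, 0 < e -> exists N, forall n, (N <= n)%nat -> Rabs (u n) < e.
Proof.
  rewrite <- is_lim_seq_spec. simpl. split.
  - intros H e He. destruct (H (mkposreal e He)) as [N HN]. exists N. intros n Hn.
    specialize (HN n Hn). simpl in HN. rewrite Rminus_0_r in HN. exact HN.
  - intros H e. destruct (H e (cond_pos e)) as [N HN]. exists N. intros n Hn.
    rewrite Rminus_0_r. auto.
Qed.

Lemma INR_eventually_ge (K : R) : exists N, forall n, (N <= n)%nat -> K <= INR n.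
Proof.
  destruct (nfloor_ex (Rmax 0 K) (Rmax_l _ _)) as [N HN]. exists (S N). intros n Hn.
  apply le_INR in Hn. rewrite S_INR in Hn. pose proof (Rmax_r 0 K). lra.
Qed.

Lemma strictly_increasing_ge_id (phi : nat -> nat) :
  (forall n, (phi n < phi (S n))%nat) -> forall n, (n <= phi n)%nat.
Proof. intros H n. induction n; [lia|]. specialize (H n). lia. Qed.

(** * Gromov products and d_eps *)

Section Hyperbolic.
Context {X : Type} (d : X -> X -> R) (p : X) (eps delta : R).
Hypothesis Hhyp : gromov_hyperbolic d delta.
Hypothesis Heps : 0 < eps.

Notation rho := (rho_eps d p eps).
Notation de := (dist_eps d p eps).
Notation gp := (gromov_product d p).
Notation E x y := (exp (- eps * gromov_product d p x y)).

Let Hd : is_metric d := proj1 Hhyp.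
Let Hgeod : geodesic_space d := proj1 (proj2 (proj2 (proj2 Hhyp))).
Let Hproper : proper_space d := proj1 (proj2 (proj2 Hhyp)).

Let Hfour := proj2 (proj2 (proj2 (proj2 Hhyp))).

Let d_tri := metric_tri d Hd.
Let d_sym := metric_sym d Hd.
Let d_nonneg := metric_nonneg d Hd.
Let e_tri := de_tri d p eps Hd Hgeod Heps.
Let e_sym := de_sym d p eps Hd Hgeod Heps.
Let e_nonneg := de_nonneg d p eps Hd Hgeod Heps.

Lemma gromov_product_sym x y : gp x y = gp y x.
Proof. unfold gromov_product. rewrite (d_sym x y). lra. Qed.

Lemma gromov_product_le_l x y : gp x y <= d p x.
Proof. unfold gromov_product. pose proof (d_tri p x y). lra. Qed.

Lemma gromov_product_nonneg x y : 0 <= gp x y.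
Proof.
  unfold gromov_product. pose proof (d_tri x p y). rewrite (d_sym x p) in *. lra.
Qed.

Lemma gromov_product_ge_dist x y : d p x - d x y <= gp x y.
Proof.
  unfold gromov_product. pose proof (d_tri p y x). rewrite (d_sym y x) in *. lra.
Qed.

Lemma gromov_product_lipschitz x y z : gp x z - d x y <= gp y z.
Proof.
  unfold gromov_product. pose proof (d_tri p y x). rewrite (d_sym y x) in *.
  pose proof (d_tri y x z). rewrite (d_sym y x) in *. lra.
Qed.

Lemma gromov_product_self x : gp x x = d p x.
Proof. unfold gromov_product. rewrite (metric_refl d Hd). lra. Qed.

Lemma gromov_product_hyp x y z k : k <= gp x y -> k <= gp y z -> k - delta <= gp x z.
Proof.
  intros H1 H2. pose proof (Hfour x y z p) as H4.
  pose proof (Rmin_glb _ _ _ H1 H2). lra.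
Qed.

(** The four-point inequality for coinciding points. *)
Lemma hyperbolicity_constant_nonneg : 0 <= delta.
Proof. pose proof (gromov_product_hyp p p p _ (Rle_refl _) (Rle_refl _)). lra. Qed.

(** Multiplicative form of the four-point inequality: [E] is a quasi-ultrametric with factor e^(eps
    delta). *)
Lemma exp_gromov_product_hyp x y z k : E x y <= k -> E y z <= k ->
  E x z <= exp (eps * delta) * k.
Proof.
  intros H1 H2. pose proof (Hfour x y z p) as H4.
  assert (H : exp (eps * delta) * E x y <= exp (eps * delta) * k /\
              exp (eps * delta) * E y z <= exp (eps * delta) * k).
  { split; apply Rmult_le_compat_l; trivial; apply Rlt_le, exp_pos. }
  rewrite <- !exp_plus in H. destruct H as [H H'].
  unfold Rmin in H4. destruct (Rle_dec (gp x y) (gp y z)).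
  - eapply Rle_trans; [|exact H]. apply exp_monotone. nra.
  - eapply Rle_trans; [|exact H']. apply exp_monotone. nra.
Qed.

Lemma exp_gromov_product_le x y k : k <= gp x y -> E x y <= exp (- eps * k).
Proof. intros H. apply exp_monotone. nra. Qed.

Lemma exp_gromov_product_near x y : E x y <= exp (eps * d x y) * rho x.
Proof.
  unfold rho_eps. rewrite <- exp_plus. apply exp_monotone.
  pose proof (gromov_product_ge_dist x y). nra.
Qed.

(** * Lengths of geodesics in the uniformized metric *)

Lemma geodesic_point_dist g x y s : is_geodesic d g x y -> 0 <= s <= d x y ->
  d x (g s) = s /\ d (g s) y = d x y - s.
Proof.
  intros (G0 & G1 & H) Hs. pose proof (d_nonneg x y). split.
  - rewrite <- G0 at 1. rewrite H by lra. rewrite Rabs_left1; lra.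
  - rewrite <- G1 at 1. rewrite H by lra. rewrite Rabs_left1; lra.
Qed.

(** This is the Gromov product of p and y based at x, the parameter on [x,y] of the point w0 at
    which the Gromov products with x and with y coincide. *)
Definition geodesic_center x y := d p x - gp x y.

Lemma geodesic_center_bounds x y : 0 <= geodesic_center x y <= d x y.
Proof.
  unfold geodesic_center. pose proof (gromov_product_le_l x y).
  pose proof (gromov_product_ge_dist x y). lra.
Qed.

(** The triangle inequalities through x and through y give two bounds with slopes -1 and 1 in [s],
    which meet at the center with value (x|y)_p. *)
Lemma geodesic_dist_base_ge g x y s : is_geodesic d g x y -> 0 <= s <= d x y ->
  gp x y + Rabs (s - geodesic_center x y) <= d p (g s).
Proof.
  intros Hg Hs. destruct (geodesic_point_dist g x y s Hg Hs) as [H1 H2].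
  pose proof (d_tri p (g s) x) as T1. rewrite (d_sym (g s) x) in T1.
  pose proof (d_tri p (g s) y) as T2.
  unfold geodesic_center, gromov_product.
  unfold Rabs. destruct (Rcase_abs _); lra.
Qed.

(* The four-point condition, applied to the point of [x,y] where the two
   Gromov products with x and y coincide. *)
Lemma geodesic_center_dist_base_le g x y : is_geodesic d g x y ->
  d p (g (geodesic_center x y)) <= gp x y + 2 * delta.
Proof.
  intros Hg. pose proof (geodesic_center_bounds x y) as Hs.
  destruct (geodesic_point_dist g x y _ Hg Hs) as [H1 H2].
  set (w := g (geodesic_center x y)) in *.
  assert (A : gp x w = (gp x y + d p w) / 2).
  { unfold gromov_product at 1. rewrite H1. unfold geodesic_center. lra. }
  assert (B : gp w y = (gp x y + d p w) / 2).
  { unfold gromov_product at 1. rewrite H2. unfold geodesic_center, gromov_product. lra. }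
  pose proof (gromov_product_hyp x w y ((gp x y + d p w) / 2)). lra.
Qed.

(** The primitive (K/eps) e^(-eps (v - s)) of the exponential bound grows by less than K/eps over
    [u,v], however long the interval is. *)
Lemma isometric_length_increasing g u v K : u <= v -> 0 <= K -> isometric_on d g u v ->
  (forall s, u <= s <= v -> rho (g s) <= K * exp (- eps * (v - s))) ->
  Rbar_le (curve_length de g u v) (Finite (K / eps)).
Proof.
  intros Huv HK Hg H.
  eapply Rbar_le_trans.
  - apply (isometric_curve_length_le d p eps Hd g u v
      (fun s => K / eps * exp (- eps * (v - s)))); trivial.
    (* The bound increases, so it is sampled at the left endpoint; e^z - 1 >= z then compares it
       with the increment of the primitive. *)
    intros s t Hs Hst Ht. exists s. split; [lra|].
    replace (- eps * (v - t)) with (- eps * (v - s) + eps * (t - s)) by ring.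
    rewrite exp_plus.
    apply Rle_trans with (K * exp (- eps * (v - s)) * (t - s)).
    { apply Rmult_le_compat_r; [lra|]. apply H. lra. }
    pose proof (exp_ineq1_le (eps * (t - s))) as Hx.
    set (Q := exp (- eps * (v - s))). assert (0 <= Q) by apply Rlt_le, exp_pos.
    assert (G : K / eps * Q * (eps * (t - s)) <= K / eps * Q * (exp (eps * (t - s)) - 1)).
    { apply Rmult_le_compat_l; [|lra]. apply Rmult_le_pos; trivial.
      apply Rdiv_le_0_compat; trivial. }
    replace (K / eps * Q * (eps * (t - s))) with (K * Q * (t - s)) in G by (field; lra).
    lra.
  - simpl. rewrite Rminus_diag, Rmult_0_r, exp_0.
    assert (0 <= K / eps) by (apply Rdiv_le_0_compat; trivial).
    pose proof (exp_pos (- eps * (v - u))). nra.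
Qed.

Lemma isometric_length_decreasing g u v K : u <= v -> 0 <= K -> isometric_on d g u v ->
  (forall s, u <= s <= v -> rho (g s) <= K * exp (- eps * (s - u))) ->
  Rbar_le (curve_length de g u v) (Finite (K / eps)).
Proof.
  intros Huv HK Hg H.
  eapply Rbar_le_trans.
  - apply (isometric_curve_length_le d p eps Hd g u v
      (fun s => - (K / eps * exp (- eps * (s - u))))); trivial.
    (* The bound now decreases, hence the sample at the right endpoint. *)
    intros s t Hs Hst Ht. exists t. split; [lra|].
    replace (- eps * (s - u)) with (- eps * (t - u) + eps * (t - s)) by ring.
    rewrite exp_plus.
    apply Rle_trans with (K * exp (- eps * (t - u)) * (t - s)).
    { apply Rmult_le_compat_r; [lra|]. apply H. lra. }
    pose proof (exp_ineq1_le (eps * (t - s))) as Hx.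
    set (Q := exp (- eps * (t - u))). assert (0 <= Q) by apply Rlt_le, exp_pos.
    assert (G : K / eps * Q * (eps * (t - s)) <= K / eps * Q * (exp (eps * (t - s)) - 1)).
    { apply Rmult_le_compat_l; [|lra]. apply Rmult_le_pos; trivial.
      apply Rdiv_le_0_compat; trivial. }
    replace (K / eps * Q * (eps * (t - s))) with (K * Q * (t - s)) in G by (field; lra).
    lra.
  - simpl. rewrite Rminus_diag, Rmult_0_r, exp_0.
    assert (0 <= K / eps) by (apply Rdiv_le_0_compat; trivial).
    pose proof (exp_pos (- eps * (v - u))). nra.
Qed.

(** Up to the center [rho] is dominated by an increasing exponential. The decay factor in the
    distance from [t] to the center is kept, since uniformity of geodesics needs it. *)
Lemma geodesic_initial_length g x y t : is_geodesic d g x y ->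
  0 <= t <= geodesic_center x y ->
  Rbar_le (curve_length de g 0 t)
    (Finite (E x y * exp (- eps * (geodesic_center x y - t)) / eps)).
Proof.
  intros Hg Ht. pose proof (geodesic_center_bounds x y) as Hc.
  apply isometric_length_increasing; [lra| | |].
  - apply Rmult_le_pos; apply Rlt_le, exp_pos.
  - apply (isometric_on_sub d g 0 (d x y)); try lra. apply geodesic_isometric, Hg.
  - intros s Hs. rewrite <- !exp_plus.
    eapply Rle_trans; [apply (rho_le_exp d p eps Heps),
      (geodesic_dist_base_ge g x y s Hg); lra|].
    rewrite Rabs_left1 by lra. apply exp_monotone. lra.
Qed.

Lemma geodesic_final_length g x y t : is_geodesic d g x y ->
  geodesic_center x y <= t <= d x y ->
  Rbar_le (curve_length de g t (d x y))
    (Finite (E x y * exp (- eps * (t - geodesic_center x y)) / eps)).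
Proof.
  intros Hg Ht. pose proof (geodesic_center_bounds x y) as Hc.
  apply isometric_length_decreasing; [lra| | |].
  - apply Rmult_le_pos; apply Rlt_le, exp_pos.
  - apply (isometric_on_sub d g 0 (d x y)); try lra. apply geodesic_isometric, Hg.
  - intros s Hs. rewrite <- !exp_plus.
    eapply Rle_trans; [apply (rho_le_exp d p eps Heps),
      (geodesic_dist_base_ge g x y s Hg); lra|].
    rewrite Rabs_right by lra. apply exp_monotone. lra.
Qed.

Lemma geodesic_length_le g x y : is_geodesic d g x y ->
  Rbar_le (curve_length de g 0 (d x y)) (Finite (2 / eps * E x y)).
Proof.
  intros Hg. pose proof (geodesic_center_bounds x y) as Hc.
  pose proof (geodesic_initial_length g x y _ Hg (conj (proj1 Hc) (Rle_refl _))) as H1.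
  pose proof (geodesic_final_length g x y _ Hg (conj (Rle_refl _) (proj2 Hc))) as H2.
  rewrite Rminus_diag, Rmult_0_r, exp_0, Rmult_1_r in H1, H2.
  replace (2 / eps * E x y) with (E x y / eps + E x y / eps) by (field; lra).
  apply (curve_length_cat de (de_refl d p eps Hd Hgeod Heps) e_tri g 0
    (geodesic_center x y) (d x y)); trivial; lra.
Qed.

Lemma de_le_exp x y : de x y <= 2 / eps * E x y.
Proof.
  destruct (Hgeod x y) as [g Hg].
  pose proof (curve_length_ge_dist de g 0 (d x y) (d_nonneg x y)) as H.
  pose proof (Rbar_le_trans _ _ _ H (geodesic_length_le g x y Hg)) as H'.
  destruct Hg as (G0 & G1 & _). rewrite G0, G1 in H'. exact H'.
Qed.

(** For nearby points the bound by [E x y] is too weak, as it does not tend to 0 with d(x,y); this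
    one is linear in d(x,y). *)
Lemma geodesic_length_le_short g x y R : is_geodesic d g x y -> d x y <= R ->
  Rbar_le (curve_length de g 0 (d x y)) (Finite (exp (eps * R) * rho x * d x y)).
Proof.
  intros Hg HR. pose proof (d_nonneg x y) as H0.
  replace (exp (eps * R) * rho x * d x y) with
    (exp (eps * R) * rho x * d x y - exp (eps * R) * rho x * 0) by ring.
  apply (isometric_curve_length_le d p eps Hd g 0 (d x y)
    (fun s => exp (eps * R) * rho x * s)).
  - apply geodesic_isometric, Hg.
  - intros s t Hs Hst Ht. exists s. split; [lra|].
    rewrite <- Rmult_minus_distr_l. apply Rmult_le_compat_r; [lra|].
    destruct (geodesic_point_dist g x y s Hg ltac:(lra)) as [Hx _].
    unfold rho_eps. rewrite <- exp_plus. apply exp_monotone.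
    pose proof (d_tri p (g s) x) as T. rewrite (d_sym (g s) x), Hx in T. nra.
Qed.

Lemma Rmin_inv_eps_pos R : 0 < R -> 0 < Rmin (/ eps) R.
Proof. intros H. apply Rmin_glb_lt; trivial. apply Rinv_0_lt_compat, Heps. Qed.

(** If d(x,y) >= 1, the center w is at distance at least 1/2 from one endpoint, and [rho] at w is at
    least e^(-2 eps delta) [E x y]; [de_lower] at w concludes. The number [B] stands for the length,
    so that its finiteness need not be known. *)
Lemma geodesic_length_ge : exists c, 0 < c /\ forall x y g B,
  is_geodesic d g x y -> 1 <= d x y ->
  Rbar_le (curve_length de g 0 (d x y)) (Finite B) -> c * E x y <= B.
Proof.
  exists (exp (-1) * exp (- eps * (2 * delta)) * Rmin (/ eps) (1 / 2)). split.
  { apply Rmult_lt_0_compat; [apply Rmult_lt_0_compat; apply exp_pos|].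
    apply Rmin_inv_eps_pos. lra. }
  intros x y g B Hg H1 HB.
  pose proof (geodesic_center_bounds x y) as Hc.
  destruct (geodesic_point_dist g x y _ Hg Hc) as [D1 D2].
  pose proof (geodesic_center_dist_base_le g x y Hg) as Dp.
  pose proof (Rbar_le_trans _ _ _ (curve_length_ge_dist2 de g 0 (geodesic_center x y)
    (d x y) (proj1 Hc) (proj2 Hc)) HB) as HB'.
  destruct Hg as (G0 & G1 & _). rewrite G0, G1 in HB'.
  set (w := g (geodesic_center x y)) in *. simpl in HB'.
  pose proof (de_lower d p eps Hd Hgeod Heps w x) as L1.
  pose proof (de_lower d p eps Hd Hgeod Heps w y) as L2.
  rewrite (e_sym x w) in HB'. rewrite (d_sym w x), D1 in L1. rewrite D2 in L2.
  pose proof (e_nonneg w x). pose proof (e_nonneg w y).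
  assert (R : exp (- eps * (2 * delta)) * E x y <= rho w).
  { rewrite <- exp_plus. eapply Rle_trans; [|apply (rho_ge_exp d p eps Heps), Dp].
    apply exp_monotone. lra. }
  assert (M : forall s, 1 / 2 <= s ->
    exp (-1) * exp (- eps * (2 * delta)) * Rmin (/ eps) (1 / 2) * E x y <=
    exp (-1) * rho w * Rmin (/ eps) s).
  { intros s Hs.
    replace (exp (-1) * exp (- eps * (2 * delta)) * Rmin (/ eps) (1 / 2) * E x y)
      with (exp (-1) * (exp (- eps * (2 * delta)) * E x y) * Rmin (/ eps) (1 / 2)) by ring.
    apply Rmult_le_compat.
    - apply Rmult_le_pos; [|apply Rmult_le_pos]; apply Rlt_le, exp_pos.
    - apply Rlt_le, Rmin_inv_eps_pos. lra.
    - apply Rmult_le_compat_l; trivial. apply Rlt_le, exp_pos.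
    - apply Rle_min_compat_l. exact Hs. }
  destruct (Rle_dec (1 / 2) (geodesic_center x y)) as [Hl|Hl].
  - specialize (M _ Hl). lra.
  - specialize (M (d x y - geodesic_center x y) ltac:(lra)). lra.
Qed.

(** For d(x,y) < 1 the length may be tiny, but then [E x y] is at most e^eps rho(x), which the extra
    summand absorbs. *)
Lemma geodesic_length_ge_all : exists c, 0 < c /\ forall x y g B, 0 <= B ->
  is_geodesic d g x y ->
  Rbar_le (curve_length de g 0 (d x y)) (Finite B) -> c * E x y <= B + rho x.
Proof.
  destruct geodesic_length_ge as (c & Hc & H).
  exists (Rmin c (exp (- eps))). split; [apply Rmin_glb_lt; trivial; apply exp_pos|].
  intros x y g B HB0 Hg HB. pose proof (exp_pos (- eps * gp x y)) as HE.
  pose proof (rho_nonneg d p eps x) as Hrho.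
  destruct (Rle_dec 1 (d x y)) as [H1|H1].
  - specialize (H x y g B Hg H1 HB). pose proof (Rmin_l c (exp (- eps))). nra.
  - pose proof (exp_gromov_product_near x y) as G.
    apply Rle_trans with (exp (- eps) * (exp (eps * d x y) * rho x)).
    + apply Rmult_le_compat; trivial; [apply Rmin_glb; [lra|apply Rlt_le, exp_pos]|lra|apply Rmin_r].
    + rewrite <- Rmult_assoc, <- exp_plus.
      assert (exp (- eps + eps * d x y) <= 1)
        by (rewrite <- exp_0; apply exp_monotone; nra).
      nra.
Qed.

(** Pairs at distance above [R] use the bound of the length by [E]; the others compare the linear
    upper bound for the length with [de_lower]. *)
Lemma GH_theorem_of_lower_bound c R : 0 < c -> 0 < R ->
  (forall x y, R < d x y -> c * E x y <= de x y) -> GH_theorem d de.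
Proof.
  intros Hc HR H.
  (* The slope is chosen so that min(1/eps, s) >= min(1/(eps R), 1) s for 0 <= s <= R. *)
  set (k := exp (-1) * Rmin (/ eps / R) 1).
  assert (HeR : 0 < / eps / R) by (apply Rdiv_lt_0_compat; trivial; apply Rinv_0_lt_compat, Heps).
  assert (Hk : 0 < k).
  { apply Rmult_lt_0_compat; [apply exp_pos|]. apply Rmin_glb_lt; lra. }
  assert (P1 : 0 < 2 / eps / c) by (repeat apply Rdiv_lt_0_compat; lra).
  assert (P2 : 0 < exp (eps * R) / k) by (apply Rdiv_lt_0_compat; trivial; apply exp_pos).
  exists (2 / eps / c + exp (eps * R) / k). split; [lra|].
  intros x y g Hg. pose proof (e_nonneg x y) as He.
  destruct (Rlt_dec R (d x y)) as [Hlt|Hge].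
  - eapply Rbar_le_trans; [apply geodesic_length_le, Hg|]. simpl.
    specialize (H x y Hlt).
    apply Rle_trans with (2 / eps / c * de x y); [|nra].
    replace (2 / eps * E x y) with (2 / eps / c * (c * E x y)) by (field; lra).
    apply Rmult_le_compat_l; lra.
  - eapply Rbar_le_trans; [apply (geodesic_length_le_short g x y R Hg); lra|]. simpl.
    apply Rle_trans with (exp (eps * R) / k * de x y); [|nra].
    assert (L : k * (rho x * d x y) <= de x y).
    { eapply Rle_trans; [|apply (de_lower d p eps Hd Hgeod Heps)].
      unfold k. pose proof (d_nonneg x y) as H0.
      assert (Rmin (/ eps / R) 1 * d x y <= Rmin (/ eps) (d x y)).
      { apply Rmin_glb.
        - apply Rle_trans with (/ eps / R * R); [|right; field; lra].
          apply Rmult_le_compat; try lra; [apply Rmin_glb; lra|apply Rmin_l].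
        - pose proof (Rmin_r (/ eps / R) 1). nra. }
      replace (exp (-1) * Rmin (/ eps / R) 1 * (rho x * d x y)) with
        (exp (-1) * rho x * (Rmin (/ eps / R) 1 * d x y)) by ring.
      apply Rmult_le_compat_l; trivial.
      apply Rmult_le_pos; [apply Rlt_le, exp_pos|apply rho_nonneg]. }
    replace (exp (eps * R) * rho x * d x y) with
      (exp (eps * R) / k * (k * (rho x * d x y))) by (field; lra).
    apply Rmult_le_compat_l; lra.
Qed.

(** * Small distances, large Gromov products and boundary points *)

Lemma exp_small e : 0 < e -> exists K, exp (- eps * K) < e.
Proof.
  intros He. exists (- ln (e / 2) / eps).
  replace (- eps * (- ln (e / 2) / eps)) with (ln (e / 2)) by (field; lra).
  rewrite exp_ln by lra. lra.
Qed.

Lemma de_small_of_gromov_product e : 0 < e ->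
  exists K, forall x y, K <= gp x y -> de x y < e.
Proof.
  intros He. destruct (exp_small (e * eps / 2)) as [K HK].
  { apply Rdiv_lt_0_compat; [|lra]. apply Rmult_lt_0_compat; trivial. }
  exists K. intros x y H.
  eapply Rle_lt_trans; [apply de_le_exp|].
  pose proof (exp_gromov_product_le x y K H) as H1.
  apply Rle_lt_trans with (2 / eps * exp (- eps * K)).
  - apply Rmult_le_compat_l; trivial. apply Rlt_le, Rdiv_lt_0_compat; lra.
  - replace e with (2 / eps * (e * eps / 2)) at 1 by (field; lra).
    apply Rmult_lt_compat_l; trivial. apply Rdiv_lt_0_compat; lra.
Qed.

Lemma gromov_product_large_of_exp K : exists e, 0 < e /\
  forall x y, E x y < e -> K <= gp x y.
Proof.
  exists (exp (- eps * K)). split; [apply exp_pos|]. intros x y H.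
  apply exp_lt_inv in H. nra.
Qed.

(** The distances to the terms of a Cauchy sequence are Cauchy, so [dist_to_bpt] is a genuine finite
    limit and not a default value of [real] or [Lim_seq]. *)
Lemma dist_to_bpt_lim z xi : cauchy_seq de xi ->
  is_lim_seq (fun m => de z (xi m)) (dist_to_bpt de z xi).
Proof.
  intros H. assert (Hf : ex_finite_lim_seq (fun m => de z (xi m))).
  { apply ex_lim_seq_cauchy_corr. intros e. destruct (H e (cond_pos e)) as [N HN].
    exists N. intros n m Hn Hm. specialize (HN n m Hn Hm).
    pose proof (e_tri z (xi n) (xi m)). pose proof (e_tri z (xi m) (xi n)).
    rewrite (e_sym (xi m) (xi n)) in *. apply Rabs_def1; lra. }
  destruct Hf as [l Hl]. unfold dist_to_bpt. rewrite (is_lim_seq_unique _ _ Hl). exact Hl.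
Qed.

Lemma dist_to_bpt_le z xi b N : cauchy_seq de xi ->
  (forall m, (N <= m)%nat -> de z (xi m) <= b) -> dist_to_bpt de z xi <= b.
Proof.
  intros H Hb. pose proof (dist_to_bpt_lim z xi H) as L.
  apply (is_lim_seq_le_loc (fun m => de z (xi m)) (fun _ => b) (dist_to_bpt de z xi) b); trivial.
  - exists N. exact Hb.
  - apply is_lim_seq_const.
Qed.

Lemma dist_to_bpt_ge z xi b N : cauchy_seq de xi ->
  (forall m, (N <= m)%nat -> b <= de z (xi m)) -> b <= dist_to_bpt de z xi.
Proof.
  intros H Hb. pose proof (dist_to_bpt_lim z xi H) as L.
  apply (is_lim_seq_le_loc (fun _ => b) (fun m => de z (xi m)) b (dist_to_bpt de z xi)); trivial.
  - exists N. exact Hb.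
  - apply is_lim_seq_const.
Qed.

Lemma dist_to_bpt_nonneg z xi : cauchy_seq de xi -> 0 <= dist_to_bpt de z xi.
Proof. intros H. apply (dist_to_bpt_ge z xi 0 0 H). intros; apply e_nonneg. Qed.

Lemma dist_to_bpt_tri z w xi : cauchy_seq de xi ->
  dist_to_bpt de z xi <= de z w + dist_to_bpt de w xi.
Proof.
  intros H. pose proof (dist_to_bpt_lim z xi H) as L1.
  pose proof (is_lim_seq_plus' _ _ _ _ (is_lim_seq_const (de z w)) (dist_to_bpt_lim w xi H)) as L2.
  apply (is_lim_seq_le _ _ _ _ (fun m => e_tri z w (xi m)) L1 L2).
Qed.

Lemma cauchy_dist_to_bpt xi : cauchy_seq de xi ->
  forall e, 0 < e -> exists N, forall n, (N <= n)%nat -> dist_to_bpt de (xi n) xi < e.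
Proof.
  intros H e He. destruct (H (e / 2) ltac:(lra)) as [N HN]. exists N. intros n Hn.
  apply Rle_lt_trans with (e / 2); [|lra].
  apply (dist_to_bpt_le _ _ _ N H). intros m Hm. apply Rlt_le, HN; trivial.
Qed.

(** Otherwise infinitely many terms lie in a ball, which is compact by properness. A subsequence
    then converges for [d], hence for [de], and the Cauchy property makes the whole sequence
    converge in X. *)
Lemma boundary_seq_unbounded xi : boundary_seq de xi ->
  forall K, exists N, forall n, (N <= n)%nat -> K <= d p (xi n).
Proof.
  intros [HC HN] K. apply NNPP. intros Hno. apply HN.
  assert (Hf : forall N, exists n, (N <= n)%nat /\ d p (xi n) <= K).
  { intros N. apply NNPP. intros H. apply Hno. exists N. intros n Hn.
    apply Rnot_lt_le. intros Hlt. apply H. exists n. split; trivial. lra. }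
  destruct (functional_choice _ Hf) as [f Hf'].
  destruct (Hproper p K (fun n => xi (f n))) as (phi & z & Hphi & _ & Hz).
  { intros n. apply Hf'. }
  pose proof (strictly_increasing_ge_id phi Hphi) as Hge.
  exists z. apply lim_seq_0_iff. intros e He.
  destruct (HC (e / 2) ltac:(lra)) as [N1 HN1].
  destruct (proj1 (lim_seq_0_iff _) Hz (e / 2) ltac:(lra)) as [N2 HN2].
  exists N1. intros n Hn. rewrite Rabs_right by (apply Rle_ge, e_nonneg).
  set (k := Nat.max N1 N2).
  assert (Hk1 : (k <= phi k)%nat) by apply Hge.
  assert (Hk2 : (phi k <= f (phi k))%nat) by apply Hf'.
  specialize (HN1 n (f (phi k)) Hn ltac:(lia)).
  specialize (HN2 k ltac:(lia)). apply Rabs_def2 in HN2.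
  pose proof (e_tri (xi n) (xi (f (phi k))) z).
  pose proof (de_le_d d p eps Hd Hgeod Heps (xi (f (phi k))) z). lra.
Qed.

(** A limit [z] in X is impossible: [de_lower] keeps points at [d]-distance at least 1/eps from [z]
    at [de]-distance at least rho(z)/(e eps), while d(p,u_n) = (u_n|u_n)_p tends to infinity. *)
Lemma gromov_seq_boundary u : gromov_seq d p u -> boundary_seq de u.
Proof.
  intros Hu. split.
  - intros e He. destruct (de_small_of_gromov_product e He) as [K HK].
    destruct (Hu K) as [N HN]. exists N. intros n m Hn Hm. apply HK.
    apply Rge_le, HN; trivial.
  - intros [z Hz].
    set (e := exp (-1) * rho z * / eps).
    assert (He : 0 < e).
    { repeat apply Rmult_lt_0_compat; [apply exp_pos|apply rho_pos|].
      apply Rinv_0_lt_compat, Heps. }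
    destruct (proj1 (lim_seq_0_iff _) Hz e He) as [N1 HN1].
    destruct (Hu (d p z + / eps)) as [N2 HN2].
    set (n := Nat.max N1 N2).
    specialize (HN1 n ltac:(lia)). specialize (HN2 n n ltac:(lia) ltac:(lia)).
    rewrite gromov_product_self in HN2.
    apply Rabs_def2 in HN1. rewrite e_sym in HN1.
    pose proof (de_lower d p eps Hd Hgeod Heps z (u n)) as L.
    rewrite Rmin_left in L; [unfold e in HN1; lra|].
    pose proof (d_tri p z (u n)). lra.
Qed.

(** Based at [o] the product is exactly min(s,t); changing the base point to [p] costs at most
    d(o,p). Both base points occur: rough starlikeness supplies rays from [o], the Gromov boundary
    rays from [p]. *)
Lemma ray_gromov_product o g s t : is_ray d g o -> 0 <= s -> 0 <= t ->
  Rmin s t - d o p <= gp (g s) (g t).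
Proof.
  intros [G0 H] Hs Ht. unfold gromov_product. rewrite (H s t Hs Ht).
  pose proof (H 0 s (Rle_refl 0) Hs) as H1. pose proof (H 0 t (Rle_refl 0) Ht) as H2.
  rewrite G0, Rabs_left1 in H1, H2 by lra.
  pose proof (d_tri o p (g s)). pose proof (d_tri o p (g t)).
  unfold Rmin, Rabs. destruct (Rle_dec s t), (Rcase_abs (s - t)); lra.
Qed.

Lemma ray_gromov_seq o g : is_ray d g o -> gromov_seq d p (fun k => g (INR k)).
Proof.
  intros Hg K. destruct (INR_eventually_ge (K + d o p)) as [N HN]. exists N.
  intros n m Hn Hm. pose proof (ray_gromov_product o g _ _ Hg (pos_INR n) (pos_INR m)).
  pose proof (Rmin_glb _ _ _ (HN n Hn) (HN m Hm)). lra.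
Qed.

Lemma ray_boundary_seq o g : is_ray d g o -> boundary_seq de (fun k => g (INR k)).
Proof. intros H. apply gromov_seq_boundary, (ray_gromov_seq o), H. Qed.

Lemma ray_dist_base g t : is_ray d g p -> 0 <= t -> d p (g t) = t.
Proof.
  intros [G0 H] Ht. rewrite <- G0 at 1. rewrite H by lra. rewrite Rabs_left1; lra.
Qed.

(** For k >= t the consecutive products along g(t), g(k), g'(k), g'(t) are at least t. Two uses of
    the four-point inequality give (g(t)|g'(t))_p >= t - 2 delta, which is the bound 4 delta on the
    distance. *)
Lemma rays_bounded_of_gromov_product g g' : is_ray d g p -> is_ray d g' p ->
  (forall K, exists k, K <= INR k /\ K <= gp (g (INR k)) (g' (INR k))) ->
  forall t, 0 <= t -> d (g t) (g' t) <= 4 * delta.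
Proof.
  pose proof hyperbolicity_constant_nonneg.
  intros Hg Hg' H' t Ht. destruct (H' t) as (k & Hk1 & Hk2).
  pose proof (ray_gromov_product p g t (INR k) Hg Ht (pos_INR k)) as H1.
  pose proof (ray_gromov_product p g' (INR k) t Hg' (pos_INR k) Ht) as H2.
  rewrite (metric_refl d Hd), Rminus_0_r in H1, H2.
  rewrite Rmin_left in H1 by lra. rewrite Rmin_right in H2 by lra.
  pose proof (gromov_product_hyp _ _ _ _ H1 Hk2) as H3.
  pose proof (gromov_product_hyp (g t) (g' (INR k)) (g' t) (t - delta) H3 ltac:(lra)) as H4.
  unfold gromov_product in H4.
  rewrite (ray_dist_base g t Hg Ht), (ray_dist_base g' t Hg' Ht) in H4. lra.
Qed.

End Hyperbolic.

(** * Interleaved sequences *)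

Definition interleave {X : Type} (u v : nat -> X) (n : nat) : X :=
  if Nat.even n then u (Nat.div2 n) else v (Nat.div2 n).

Lemma interleave_even {X : Type} (u v : nat -> X) k : interleave u v (2 * k) = u k.
Proof.
  unfold interleave. rewrite Nat.even_mul, Nat.div2_double. reflexivity.
Qed.

Lemma interleave_odd {X : Type} (u v : nat -> X) k : interleave u v (S (2 * k)) = v k.
Proof.
  unfold interleave. rewrite Nat.even_succ, Nat.div2_succ_double.
  rewrite <- Nat.negb_even, Nat.even_mul. reflexivity.
Qed.

Lemma interleave_cases {X : Type} (u v : nat -> X) (P : X -> Prop) N :
  (forall k, (N <= k)%nat -> P (u k) /\ P (v k)) ->
  forall n, (2 * N <= n)%nat -> P (interleave u v n).
Proof.
  intros H n Hn. destruct (Nat.Even_or_Odd n) as [[k ->]|[k ->]].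
  - rewrite interleave_even. apply H. lia.
  - rewrite Nat.add_1_r, interleave_odd. apply H. lia.
Qed.

(** * Limits of geodesics *)

Section RayLimit.
Context {X : Type} (d : X -> X -> R) (p : X).
Hypothesis Hd : is_metric d.
Hypothesis Hgeod : geodesic_space d.
Hypothesis Hproper : proper_space d.

(** Unit geodesics between consecutive points are glued. The path through integer points bounds
    d(g(s),g(t)) above by t - s, and a smaller value would contradict the prescribed distance
    between the integer points enclosing s and t. *)
Lemma ray_of_integer_points (z : nat -> X) : z O = p ->
  (forall i j, d (z i) (z j) = Rabs (INR i - INR j)) ->
  exists g, is_ray d g p /\ forall k, g (INR k) = z k.
Proof.
  intros Hz0 Hz.
  destruct (functional_choice (fun k g => is_geodesic d g (z k) (z (S k)))) as [K HK].
  { intros k. apply Hgeod. }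
  assert (H1 : forall k, d (z k) (z (S k)) = 1).
  { intros k. rewrite Hz, S_INR, Rabs_left; lra. }
  destruct (functional_choice (fun t n => 0 <= t -> INR n <= t < INR n + 1)) as [fl Hfl].
  { intros t. destruct (Rle_dec 0 t) as [Ht|Ht].
    - destruct (nfloor_ex t Ht) as [n Hn]. exists n. auto.
    - exists O. lra. }
  set (g := fun t => K (fl t) (t - INR (fl t))).
  assert (HL : forall t, 0 <= t -> d (z (fl t)) (g t) = t - INR (fl t)).
  { intros t Ht. destruct (HK (fl t)) as (G0 & _ & G). specialize (Hfl t Ht).
    rewrite <- G0 at 1. unfold g. rewrite H1 in G. rewrite G by lra.
    rewrite Rabs_left1; lra. }
  assert (HR : forall t, 0 <= t -> d (g t) (z (S (fl t))) = INR (fl t) + 1 - t).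
  { intros t Ht. destruct (HK (fl t)) as (_ & G1 & G). specialize (Hfl t Ht).
    rewrite H1 in G1, G. rewrite <- G1 at 1. unfold g. rewrite G by lra.
    rewrite Rabs_left1; lra. }
  assert (Hint : forall k, g (INR k) = z k).
  { intros k. pose proof (Hfl (INR k) (pos_INR k)) as Hk.
    assert (E : fl (INR k) = k).
    { destruct Hk as [Ha Hb]. apply INR_le in Ha. rewrite <- S_INR in Hb.
      apply INR_lt in Hb. lia. }
    unfold g. rewrite E, Rminus_diag. apply HK. }
  assert (Hle : forall s t, 0 <= s -> s <= t -> d (g s) (g t) = t - s).
  { intros s t Hs Hst. pose proof (Hfl s Hs) as Fs. pose proof (Hfl t ltac:(lra)) as Ft.
    pose proof (HL s Hs) as Ls. pose proof (HR s Hs) as Rs.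
    pose proof (HL t ltac:(lra)) as Lt. pose proof (HR t ltac:(lra)) as Rt.
    destruct (Nat.eq_dec (fl s) (fl t)) as [E|NE].
    - destruct (HK (fl s)) as (_ & _ & G). rewrite H1 in G. unfold g.
      rewrite <- E in *. rewrite G by lra. rewrite Rabs_left1; lra.
    - assert (Hlt : (fl s < fl t)%nat).
      { assert (INR (fl s) < INR (S (fl t))) by (rewrite S_INR; lra).
        apply INR_lt in H. lia. }
      assert (Hlt' : INR (S (fl s)) <= INR (fl t)) by (apply le_INR; lia).
      rewrite S_INR in Hlt'.
      pose proof (Hz (S (fl s)) (fl t)) as Z1. rewrite S_INR, Rabs_left1 in Z1 by lra.
      pose proof (Hz (fl s) (S (fl t))) as Z2. rewrite S_INR, Rabs_left1 in Z2 by lra.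
      pose proof (metric_tri d Hd (g s) (z (S (fl s))) (g t)).
      pose proof (metric_tri d Hd (z (S (fl s))) (z (fl t)) (g t)).
      pose proof (metric_tri d Hd (z (fl s)) (g s) (z (S (fl t)))).
      pose proof (metric_tri d Hd (g s) (g t) (z (S (fl t)))).
      lra. }
  exists g. split; [split|]; trivial.
  - rewrite <- Hz0. apply (Hint O).
  - intros s t Hs Ht. destruct (Rle_dec s t).
    + rewrite Hle by lra. rewrite Rabs_left1; lra.
    + rewrite (metric_sym d Hd), Hle by lra. rewrite Rabs_right; lra.
Qed.

(** Arzela-Ascoli argument at integer parameters: the points at distance k from p on the geodesics
    [p,x_n] converge along a diagonal selection. Then [phi k] picks one geodesic whose k-th point is
    within 1 of the limit, whence the loss of 1; [phi] need not be monotone. *)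
Lemma ray_limit (x : nat -> X) : (forall n, INR n <= d p (x n)) ->
  exists g phi, is_ray d g p /\ forall k : nat,
    (k <= phi k)%nat /\ INR k - 1 <= gromov_product d p (x (phi k)) (g (INR k)).
Proof.
  intros Hx.
  destruct (functional_choice (fun n g => is_geodesic d g p (x n))) as [G HG].
  { intros n. apply Hgeod. }
  (* The truncation can only take effect when n < k. *)
  set (h := fun n k => G n (Rmin (INR k) (d p (x n)))).
  assert (Hb : forall n k, 0 <= Rmin (INR k) (d p (x n)) <= d p (x n)).
  { intros n k. split; [|apply Rmin_r].
    apply Rmin_glb; [apply pos_INR|apply metric_nonneg, Hd]. }
  assert (Hhp : forall n k, d p (h n k) = Rmin (INR k) (d p (x n))).
  { intros n k. destruct (HG n) as (G0 & _ & Hiso). rewrite <- G0 at 1. unfold h.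
    specialize (Hb n k). rewrite Hiso by lra. rewrite Rabs_left1; lra. }
  assert (Hmin : forall n k, (k <= n)%nat -> Rmin (INR k) (d p (x n)) = INR k).
  { intros n k Hk. apply Rmin_left. apply le_INR in Hk. specialize (Hx n). lra. }
  (* One stage of the extraction: given the stage k and the current selection of indices, choose a
     refinement along which the k-th points converge, together with their limit. *)
  destruct (functional_choice (fun (kf : nat * (nat -> nat)) (fz : (nat -> nat) * X) =>
    (exists phi, (forall n, (n <= phi n)%nat) /\ fst fz = fun n => snd kf (phi n)) /\
    is_lim_seq (fun n => d (h (fst fz n) (fst kf)) (snd fz)) 0)) as [step Hstep].
  { intros [k f]. simpl.
    destruct (Hproper p (INR k) (fun n => h (f n) k)) as (phi & z & Hphi & _ & Hz).
    { intros n. rewrite Hhp. apply Rmin_l. }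
    exists (fun n => f (phi n), z). simpl. split; trivial.
    exists phi. split; trivial. apply strictly_increasing_ge_id, Hphi. }
  set (F := fix F k := match k with
    O => fun n => n | S k => fst (step (k, F k)) end).
  set (z := fun k => snd (step (k, F k))).
  assert (HF : forall k n, (n <= F k n)%nat).
  { induction k; intros n; simpl; [lia|].
    destruct (Hstep (k, F k)) as ((phi & Hphi & ->) & _). simpl.
    etransitivity; [apply Hphi|apply IHk]. }
  (* The selection [F k] has passed the stages 0 to k - 1, hence the strict inequality j < k. *)
  assert (Hconv : forall k j, (j < k)%nat -> forall e, 0 < e ->
    exists N, forall n, (N <= n)%nat -> d (h (F k n) j) (z j) < e).
  { induction k; intros j Hj e He; [lia|].
    destruct (Hstep (k, F k)) as ((phi & Hphi & Eq) & Hl).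
    destruct (Nat.eq_dec j k) as [->|Hne].
    - destruct (proj1 (lim_seq_0_iff _) Hl e He) as [N HN]. exists N. intros n Hn.
      specialize (HN n Hn). apply Rabs_def2 in HN. simpl in *. apply HN.
    - destruct (IHk j ltac:(lia) e He) as [N HN]. exists N. intros n Hn.
      simpl. rewrite Eq. simpl. apply HN. etransitivity; [exact Hn|apply Hphi]. }
  assert (Hz : forall i j, d (z i) (z j) = Rabs (INR i - INR j)).
  { intros i j. apply cond_eq. intros e He.
    set (k := S (Nat.max i j)).
    destruct (Hconv k i ltac:(lia) (e / 2) ltac:(lra)) as [N1 HN1].
    destruct (Hconv k j ltac:(lia) (e / 2) ltac:(lra)) as [N2 HN2].
    set (n := Nat.max k (Nat.max N1 N2)).
    specialize (HN1 n ltac:(lia)). specialize (HN2 n ltac:(lia)).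
    pose proof (HF k n) as HFn. set (m := F k n) in *.
    assert (Hij : d (h m i) (h m j) = Rabs (INR i - INR j)).
    { destruct (HG m) as (_ & _ & Hiso). unfold h.
      rewrite Hiso by apply Hb. rewrite !Hmin by lia. reflexivity. }
    rewrite <- Hij.
    pose proof (metric_tri d Hd (z i) (h m i) (z j)).
    pose proof (metric_tri d Hd (h m i) (h m j) (z j)).
    pose proof (metric_tri d Hd (h m i) (z i) (h m j)).
    pose proof (metric_tri d Hd (z i) (z j) (h m j)).
    rewrite (metric_sym d Hd (z i) (h m i)), (metric_sym d Hd (z j) (h m j)) in *.
    apply Rabs_def1; lra. }
  assert (Hz0 : z O = p).
  { symmetry. apply (proj1 (proj2 Hd)). apply cond_eq. intros e He.
    destruct (Hconv 1%nat O ltac:(lia) e He) as [N HN]. specialize (HN N (le_n N)).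
    set (m := F 1%nat N) in *.
    pose proof (metric_tri d Hd p (h m O) (z O)) as T.
    rewrite Hhp, Hmin in T by lia. simpl in T.
    rewrite Rminus_0_r, Rabs_right by (apply Rle_ge, metric_nonneg, Hd). lra. }
  destruct (ray_of_integer_points z Hz0 Hz) as (g & Hg & Hgz).
  destruct (functional_choice (fun (k n : nat) => (k <= n)%nat /\ d (h n k) (z k) < 1)) as [phi Hphi].
  { intros k. destruct (Hconv (S k) k ltac:(lia) 1 ltac:(lra)) as [N HN].
    exists (F (S k) (Nat.max N k)). split.
    - etransitivity; [|apply HF]. lia.
    - apply HN. lia. }
  exists g, phi. split; trivial. intros k. destruct (Hphi k) as [Hk Hdk].
  split; trivial. rewrite Hgz. set (n := phi k) in *.
  assert (Hxh : d (h n k) (x n) = d p (x n) - INR k).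
  { destruct (HG n) as (_ & G1 & Hiso). rewrite <- G1 at 1. unfold h.
    specialize (Hb n k). rewrite Hiso by lra. rewrite Rabs_left1 by lra.
    rewrite Hmin by trivial. lra. }
  pose proof (Hhp n k) as Hph. rewrite Hmin in Hph by trivial.
  unfold gromov_product.
  pose proof (metric_tri d Hd p (z k) (h n k)).
  pose proof (metric_tri d Hd (x n) (h n k) (z k)).
  rewrite (metric_sym d Hd (x n) (h n k)), (metric_sym d Hd (z k) (h n k)) in *. lra.
Qed.

End RayLimit.

(** * Equivalence of the Gehring-Hayman conditions *)

Section Equivalences.
Context {X : Type} (d : X -> X -> R) (p : X) (eps delta : R).
Hypothesis Hhyp : gromov_hyperbolic d delta.
Hypothesis Heps : 0 < eps.

Notation rho := (rho_eps d p eps).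
Notation de := (dist_eps d p eps).
Notation gp := (gromov_product d p).
Notation E x y := (exp (- eps * gromov_product d p x y)).

Let Hd : is_metric d := proj1 Hhyp.
Let Hgeod : geodesic_space d := proj1 (proj2 (proj2 (proj2 Hhyp))).
Let Hproper : proper_space d := proj1 (proj2 (proj2 Hhyp)).
Let Hdelta := hyperbolicity_constant_nonneg d p delta Hhyp.

Lemma GH_theorem_boundary_points : GH_theorem d de -> GH_boundary_points d de.
Proof.
  intros (A & HA & H) xi _ u _. exists (Rmax 1 A). split; [apply Rmax_l|].
  intros n m g Hg. eapply Rbar_le_trans; [apply H, Hg|]. simpl.
  apply Rmult_le_compat_r; [apply (de_nonneg d p eps Hd Hgeod Heps)|apply Rmax_r].
Qed.

(** The Gehring-Hayman bound and [geodesic_length_ge_all] give c [E x y] <= C [de x y] + rho(x), so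
    small distance and small density force a large product. *)
Lemma gromov_product_large_of_GH C K : exists e, 0 < e /\ forall x y,
  (forall g, is_geodesic d g x y ->
     Rbar_le (curve_length de g 0 (d x y)) (Finite (C * de x y))) ->
  0 <= C -> de x y < e -> rho x < e -> K <= gp x y.
Proof.
  destruct (geodesic_length_ge_all d p eps delta Hhyp Heps) as (c & Hc & HL).
  destruct (gromov_product_large_of_exp d p eps Heps K) as (e0 & He0 & HE).
  destruct (Rle_dec 0 C) as [HC|HC].
  2:{ exists 1. split; [lra|]. intros; lra. }
  (* Chosen so that C + 1 times this number is c e0. *)
  exists (c * e0 / (C + 1)).
  assert (He : 0 < c * e0 / (C + 1)) by (apply Rdiv_lt_0_compat; nra).
  split; trivial. intros x y HG _ Hde Hrho. apply HE.
  destruct (Hgeod x y) as [g Hg].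
  pose proof (de_nonneg d p eps Hd Hgeod Heps x y) as H0.
  pose proof (HL x y g (C * de x y) ltac:(nra) Hg (HG g Hg)) as H1.
  assert (H2 : C * de x y + rho x < (C + 1) * (c * e0 / (C + 1))) by nra.
  replace ((C + 1) * (c * e0 / (C + 1))) with (c * e0) in H2 by (field; lra). nra.
Qed.

Lemma rho_small e : 0 < e -> exists K, forall x, K <= d p x -> rho x < e.
Proof.
  intros He. destruct (exp_small eps Heps e He) as [K HK]. exists K. intros x Hx.
  eapply Rle_lt_trans; [apply (rho_le_exp d p eps Heps), Hx|exact HK].
Qed.

(** A Gromov sequence represents a boundary point, and it converges to the very point it
    represents. *)
Lemma GH_boundary_points_gromov_seq : GH_boundary_points d de -> GH_gromov_seq d de p.
Proof.
  intros H u Hu.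
  pose proof (gromov_seq_boundary d p eps delta Hhyp Heps u Hu) as Hb.
  apply (H u Hb). apply lim_seq_0_iff. intros e He.
  destruct (cauchy_dist_to_bpt d p eps delta Hhyp Heps u (proj1 Hb) e He) as [N HN].
  exists N. intros n Hn. rewrite Rabs_right; [auto|].
  apply Rle_ge, (dist_to_bpt_nonneg d p eps delta Hhyp Heps), Hb.
Qed.

(** Property (1) is applied to [xi] as a sequence converging to its own boundary point; its terms
    leave every ball, so [rho] tends to 0 along it. *)
Lemma boundary_points_gromov_seq xi : GH_boundary_points d de ->
  boundary_seq de xi -> gromov_seq d p xi.
Proof.
  intros H Hb.
  destruct (H xi Hb xi) as (C & HC & HG).
  { apply lim_seq_0_iff. intros e He.
    destruct (cauchy_dist_to_bpt d p eps delta Hhyp Heps xi (proj1 Hb) e He) as [N HN].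
    exists N. intros n Hn. rewrite Rabs_right; [auto|].
    apply Rle_ge, (dist_to_bpt_nonneg d p eps delta Hhyp Heps), Hb. }
  intros K. destruct (gromov_product_large_of_GH C K) as (e & He & HL).
  destruct (proj1 Hb e He) as [N1 HN1].
  destruct (rho_small e He) as [K' HK'].
  destruct (boundary_seq_unbounded d p eps delta Hhyp Heps xi Hb K') as [N2 HN2].
  exists (Nat.max N1 N2). intros n m Hn Hm. apply Rle_ge, HL; try lra.
  - intros g. apply HG.
  - apply HN1; lia.
  - apply HK', HN2; lia.
Qed.

(** The ray is a limit of geodesics to a subsequence escaping at linear speed; the four-point
    inequality transfers the estimate to all later terms. *)
Lemma gromov_seq_ray_limit xi : gromov_seq d p xi -> exists g, is_ray d g p /\
  forall K, exists N, forall k m, (N <= k)%nat -> (N <= m)%nat -> K <= gp (g (INR k)) (xi m).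
Proof.
  intros Hxi.
  assert (Hn : forall k, exists n, (k <= n)%nat /\ INR k <= d p (xi n)).
  { intros k. destruct (Hxi (INR k)) as [N HN]. exists (Nat.max k N). split; [lia|].
    specialize (HN (Nat.max k N) (Nat.max k N) ltac:(lia) ltac:(lia)).
    rewrite (gromov_product_self d p delta Hhyp) in HN. lra. }
  destruct (functional_choice _ Hn) as [psi Hpsi].
  destruct (ray_limit d p Hd Hgeod Hproper (fun k => xi (psi k))) as (g & phi & Hg & Hphi).
  { intros k. apply Hpsi. }
  exists g. split; trivial. intros K.
  destruct (Hxi (K + delta)) as [N1 HN1].
  destruct (INR_eventually_ge (K + delta + 1)) as [N2 HN2].
  exists (Nat.max N1 N2). intros k m Hk Hm.
  destruct (Hphi k) as [Hk1 Hk2]. destruct (Hpsi (phi k)) as [Hk3 _].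
  specialize (HN2 k ltac:(lia)). specialize (HN1 (psi (phi k)) m ltac:(lia) ltac:(lia)).
  rewrite (gromov_product_sym d p delta Hhyp) in Hk2.
  pose proof (gromov_product_hyp d p delta Hhyp (g (INR k)) (xi (psi (phi k))) (xi m)
    (K + delta)). lra.
Qed.

Lemma GH_boundary_points_Phi_bijective : GH_boundary_points d de -> Phi_bijective d de p.
Proof.
  intros H. split.
  - intros g g' Hg Hg' Hlim. exists (4 * delta).
    apply (rays_bounded_of_gromov_product d p delta Hhyp g g' Hg Hg').
    set (xi := fun k => g (INR k)). set (xi' := fun k => g' (INR k)).
    assert (Hb : boundary_seq de xi) by (apply (ray_boundary_seq d p eps delta Hhyp Heps p), Hg).
    (* Injectivity: interleaving two rays with the same endpoint yields a single constant C valid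
       for all pairs g(k), g'(k). *)
    destruct (H xi Hb (interleave xi xi')) as (C & HC & HG).
    { apply lim_seq_0_iff. intros e He.
      destruct (cauchy_dist_to_bpt d p eps delta Hhyp Heps xi (proj1 Hb) (e / 2)
        ltac:(lra)) as [N1 HN1].
      destruct (proj1 (lim_seq_0_iff _) Hlim (e / 2) ltac:(lra)) as [N2 HN2].
      exists (2 * Nat.max N1 N2)%nat. intros n Hn.
      rewrite Rabs_right by
        (apply Rle_ge, (dist_to_bpt_nonneg d p eps delta Hhyp Heps), Hb).
      revert n Hn. apply interleave_cases with (P := fun w => dist_to_bpt de w xi < e).
      intros k Hk. specialize (HN1 k ltac:(lia)). specialize (HN2 k ltac:(lia)).
      split; [lra|]. apply Rabs_def2 in HN2.
      pose proof (dist_to_bpt_tri d p eps delta Hhyp Heps (xi' k) (xi k) xi (proj1 Hb)) as T.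
      rewrite (de_sym d p eps Hd Hgeod Heps (xi' k)) in T. unfold xi, xi' in *. lra. }
    intros K. destruct (gromov_product_large_of_GH C K) as (e & He & HL).
    destruct (proj1 (lim_seq_0_iff _) Hlim e He) as [N1 HN1].
    destruct (rho_small e He) as [K' HK'].
    destruct (INR_eventually_ge (Rmax K K')) as [N2 HN2].
    set (k := Nat.max N1 N2). exists k.
    specialize (HN1 k ltac:(lia)). specialize (HN2 k ltac:(lia)).
    pose proof (Rmax_l K K'). pose proof (Rmax_r K K').
    split; [lra|]. apply HL; try lra.
    + intros g0 Hg0. specialize (HG (2 * k)%nat (S (2 * k)) g0).
      rewrite interleave_even, interleave_odd in HG. apply HG, Hg0.
    + apply Rabs_def2 in HN1. lra.
    + apply HK'. rewrite (ray_dist_base d p g _ Hg (pos_INR k)). lra.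
  - intros xi Hb.
    (* Surjectivity: by (1) the sequence is a Gromov sequence, and its limit ray has the same
       endpoint. *)
    destruct (gromov_seq_ray_limit xi (boundary_points_gromov_seq xi H Hb)) as (g & Hg & Hlim).
    exists g. split; trivial. apply lim_seq_0_iff. intros e He.
    destruct (de_small_of_gromov_product d p eps delta Hhyp Heps (e / 2) ltac:(lra)) as [K HK].
    destruct (Hlim K) as [N HN]. exists N. intros n Hn.
    rewrite Rabs_right by
      (apply Rle_ge, (dist_to_bpt_nonneg d p eps delta Hhyp Heps), Hb).
    apply Rle_lt_trans with (e / 2); [|lra].
    apply (dist_to_bpt_le d p eps delta Hhyp Heps _ _ _ N (proj1 Hb)).
    intros m Hm. apply Rlt_le, HK, HN; trivial.
Qed.

(* If the lower bound failed, far apart pairs violating it would accumulate at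
   two boundary points with the same image under Phi, hence at a single one,
   and the interleaved sequence would violate the property for Gromov sequences. *)
Lemma GH_gromov_seq_GH_theorem :
  Phi_bijective d de p -> GH_gromov_seq d de p -> GH_theorem d de.
Proof.
  intros [Hinj _] HGH.
  (* Candidate constants tending to 0: if none of them is a valid lower bound, each is violated by
     some pair of points more than 1 apart. *)
  set (lb := fun n : nat => / (INR n + 1)).
  assert (Hlb : forall n, 0 < lb n).
  { intros n. apply Rinv_0_lt_compat. pose proof (pos_INR n). lra. }
  destruct (classic (exists n, forall x y, 1 < d x y -> lb n * E x y <= de x y)) as [[n Hn]|Hno].
  { apply (GH_theorem_of_lower_bound d p eps delta Hhyp Heps (lb n) 1); trivial. lra. }
  exfalso.
  assert (Hbad : forall n, exists xy : X * X,
    1 < d (fst xy) (snd xy) /\ de (fst xy) (snd xy) < lb n * E (fst xy) (snd xy)).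
  { intros n. apply NNPP. intros Hc. apply Hno. exists n. intros x y Hxy.
    apply Rnot_lt_le. intros Hlt. apply Hc. exists (x, y). auto. }
  destruct (functional_choice _ Hbad) as [xy Hxy]. clear Hno Hbad.
  assert (Hlb0 : forall e, 0 < e -> exists N, forall n, (N <= n)%nat -> lb n < e).
  { intros e He. destruct (INR_eventually_ge (/ e)) as [N HN]. exists N. intros n Hn.
    specialize (HN n Hn). unfold lb. rewrite <- (Rinv_inv e).
    assert (0 < / e) by (apply Rinv_0_lt_compat, He).
    apply Rinv_lt_contravar; [|lra]. apply Rmult_lt_0_compat; lra. }
  assert (Hde : forall n, de (fst (xy n)) (snd (xy n)) < lb n).
  { intros n. destruct (Hxy n) as [_ H]. specialize (Hlb n).
    assert (E (fst (xy n)) (snd (xy n)) <= 1).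
    { rewrite <- exp_0. apply exp_monotone.
      pose proof (gromov_product_nonneg d p delta Hhyp (fst (xy n)) (snd (xy n))). nra. }
    nra. }
  set (c0 := exp (-1) * Rmin (/ eps) 1).
  assert (Hc0 : 0 < c0).
  { apply Rmult_lt_0_compat; [apply exp_pos|]. apply (Rmin_inv_eps_pos eps Heps). lra. }
  assert (Hlow : forall x y, 1 < d x y -> c0 * rho x <= de x y).
  { intros x y H. eapply Rle_trans; [|apply (de_lower d p eps Hd Hgeod Heps)].
    unfold c0. replace (exp (-1) * Rmin (/ eps) 1 * rho x) with
      (exp (-1) * rho x * Rmin (/ eps) 1) by ring.
    apply Rmult_le_compat_l.
    - apply Rmult_le_pos; [apply Rlt_le, exp_pos|apply rho_nonneg].
    - apply Rle_min_compat_l. lra. }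
  (* Points more than 1 apart satisfy c0 rho <= [de] at both of them, so both members of a bad pair
     escape to infinity. *)
  assert (Hfar : forall k : nat, exists n, (k <= n)%nat /\
    INR k <= d p (fst (xy n)) /\ INR k <= d p (snd (xy n))).
  { intros k. destruct (Hlb0 (c0 * exp (- eps * INR k))) as [N HN].
    { apply Rmult_lt_0_compat; trivial. apply exp_pos. }
    exists (Nat.max k N). set (n := Nat.max k N). split; [lia|].
    specialize (HN n ltac:(lia)). specialize (Hde n). destruct (Hxy n) as [H1 _].
    assert (G : forall x, c0 * rho x <= de (fst (xy n)) (snd (xy n)) -> INR k <= d p x).
    { intros x Hx. assert (Hr : rho x < exp (- eps * INR k)) by nra.
      unfold rho_eps in Hr. apply exp_lt_inv in Hr. nra. }
    split; apply G; [apply Hlow, H1|].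
    rewrite (de_sym d p eps Hd Hgeod Heps). apply Hlow. rewrite (metric_sym d Hd). exact H1. }
  destruct (functional_choice _ Hfar) as [f Hf].
  destruct (ray_limit d p Hd Hgeod Hproper (fun k => fst (xy (f k)))) as (g & phi & Hg & Hphi).
  { intros k. apply Hf. }
  destruct (ray_limit d p Hd Hgeod Hproper (fun k => snd (xy (f (phi k)))))
    as (g' & psi & Hg' & Hpsi).
  { intros k. apply Rle_trans with (INR (phi k)); [apply le_INR, Hphi|apply Hf]. }
  (* The second extraction refines the first, so that both members of the pair with index [i k]
     approach their rays. *)
  set (i := fun k => f (phi (psi k))).
  set (u := fun k => fst (xy (i k))). set (v := fun k => snd (xy (i k))).
  assert (Hi : forall k, (k <= i k)%nat).
  { intros k. unfold i. destruct (Hpsi k) as [A _]. destruct (Hphi (psi k)) as [B _].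
    destruct (Hf (phi (psi k))) as [C _]. lia. }
  assert (Hu : forall k, INR k - 1 - delta <= gp (u k) (g (INR k))).
  { intros k. destruct (Hphi (psi k)) as [_ B]. destruct (Hpsi k) as [A _].
    apply le_INR in A.
    pose proof (ray_gromov_product d p delta Hhyp p g (INR (psi k)) (INR k) Hg
      (pos_INR _) (pos_INR _)) as Hr.
    rewrite (metric_refl d Hd), Rminus_0_r, Rmin_right in Hr by lra.
    apply (gromov_product_hyp d p delta Hhyp (u k) (g (INR (psi k)))); [|lra].
    unfold u, i. lra. }
  assert (Hv : forall k, INR k - 1 - delta <= gp (v k) (g' (INR k))).
  { intros k. destruct (Hpsi k) as [_ A]. unfold v, i. lra. }
  assert (Hlim : is_lim_seq (fun k => de (g (INR k)) (g' (INR k))) 0).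
  { apply lim_seq_0_iff. intros e He.
    destruct (de_small_of_gromov_product d p eps delta Hhyp Heps (e / 3) ltac:(lra)) as [K HK].
    destruct (Hlb0 (e / 3) ltac:(lra)) as [N1 HN1].
    destruct (INR_eventually_ge (K + 1 + delta)) as [N2 HN2].
    exists (Nat.max N1 N2). intros k Hk.
    rewrite Rabs_right by (apply Rle_ge, (de_nonneg d p eps Hd Hgeod Heps)).
    specialize (HN2 k ltac:(lia)).
    pose proof (HK (u k) (g (INR k)) ltac:(specialize (Hu k); lra)) as A.
    pose proof (HK (v k) (g' (INR k)) ltac:(specialize (Hv k); lra)) as B.
    specialize (Hi k). pose proof (HN1 (i k) ltac:(lia)). pose proof (Hde (i k)) as C.
    fold (u k) in C. fold (v k) in C.
    pose proof (de_tri d p eps Hd Hgeod Heps (g (INR k)) (u k) (g' (INR k))).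
    pose proof (de_tri d p eps Hd Hgeod Heps (u k) (v k) (g' (INR k))).
    rewrite (de_sym d p eps Hd Hgeod Heps (u k) (g (INR k))) in A. lra. }
  destruct (Hinj g g' Hg Hg' Hlim) as [B HB].
  set (S0 := Rabs B + 1 + delta).
  assert (HS0 : 0 <= Rabs B) by apply Rabs_pos.
  assert (Hgg : forall k, INR k - S0 <= gp (g' (INR k)) (g (INR k))).
  { intros k. pose proof (HB (INR k) (pos_INR k)) as Hk.
    pose proof (gromov_product_ge_dist d p delta Hhyp (g' (INR k)) (g (INR k))) as G.
    rewrite (ray_dist_base d p g' _ Hg' (pos_INR k)), (metric_sym d Hd) in G.
    pose proof (Rle_abs B). unfold S0. lra. }
  assert (Huv : forall k, INR k - S0 - delta <= gp (u k) (g (INR k)) /\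
                          INR k - S0 - delta <= gp (v k) (g (INR k))).
  { intros k. specialize (Hu k). specialize (Hv k). specialize (Hgg k). split.
    - unfold S0. lra.
    - apply (gromov_product_hyp d p delta Hhyp (v k) (g' (INR k))); trivial.
      unfold S0. lra. }
  (* From index N on all products with g(N) exceed K + 2 delta, so those between any two terms
     exceed K + delta. In the margin 4 delta, [Huv] uses one delta and the passage from g(k) to g(N)
     another. *)
  destruct (HGH (interleave u v)) as (C & HC & HG).
  { intros K. destruct (INR_eventually_ge (K + S0 + 4 * delta)) as [N HN].
    exists (2 * N)%nat.
    assert (Hw : forall n, (2 * N <= n)%nat ->
      K + 2 * delta <= gp (interleave u v n) (g (INR N))).
    { apply interleave_cases with (P := fun w => K + 2 * delta <= gp w (g (INR N))).
      intros k Hk. pose proof (HN N (le_n N)) as HNN.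
      pose proof (ray_gromov_product d p delta Hhyp p g (INR k) (INR N) Hg
        (pos_INR _) (pos_INR _)) as Hr.
      apply le_INR in Hk.
      rewrite (metric_refl d Hd), Rminus_0_r, Rmin_right in Hr by lra.
      destruct (Huv k) as [A1 A2]. unfold S0 in *.
      split; (replace (K + 2 * delta) with (K + 3 * delta - delta) by ring);
        apply (gromov_product_hyp d p delta Hhyp _ (g (INR k))); lra. }
    intros n m Hn Hm. pose proof (Hw n Hn) as A1. pose proof (Hw m Hm) as A2.
    rewrite (gromov_product_sym d p delta Hhyp) in A2.
    pose proof (gromov_product_hyp d p delta Hhyp _ _ _ _ A1 A2). lra. }
  destruct (geodesic_length_ge d p eps delta Hhyp Heps) as (c & Hc & HL).
  (* For this N the geodesic from [u N] to [v N] would have length at least c [E], yet at most C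
     [de] < c [E]. *)
  destruct (Hlb0 (c / C)) as [N HN]; [apply Rdiv_lt_0_compat; lra|].
  destruct (Hgeod (u N) (v N)) as [g0 Hg0].
  specialize (HG (2 * N)%nat (S (2 * N)) g0).
  rewrite interleave_even, interleave_odd in HG.
  destruct (Hxy (i N)) as [H1 H2]. fold (u N) (v N) in H1, H2.
  pose proof (HL _ _ _ _ Hg0 ltac:(lra) (HG Hg0)) as H3.
  specialize (HN (i N) (Hi N)). pose proof (exp_pos (- eps * gp (u N) (v N))) as HE.
  assert (H4 : C * de (u N) (v N) < C * (c / C * E (u N) (v N))).
  { apply Rmult_lt_compat_l; [lra|]. eapply Rlt_trans; [exact H2|].
    apply Rmult_lt_compat_r; trivial. }
  replace (C * (c / C * E (u N) (v N))) with (c * E (u N) (v N)) in H4 by (field; lra).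
  lra.
Qed.

End Equivalences.

(** * Auxiliary facts on extended reals, indices and powers *)

Lemma Rbar_mult_pos_ge (A a : R) (x : Rbar) : 0 < A ->
  Rbar_le a x -> Rbar_le (A * a) (Rbar_mult A x).
Proof.
  intros HA H. destruct x as [x| |]; simpl in *; [nra| |tauto].
  destruct (Rle_dec 0 A); [|lra]. destruct (Rle_lt_or_eq_dec 0 A r); simpl; trivial. lra.
Qed.

Lemma Rbar_mult_pos_le (A a : R) (x : Rbar) : 0 < A ->
  Rbar_le x a -> Rbar_le (Rbar_mult A x) (A * a).
Proof.
  intros HA H. destruct x as [x| |]; simpl in *; [nra|tauto|].
  destruct (Rle_dec 0 A); [|lra]. destruct (Rle_lt_or_eq_dec 0 A r); simpl; trivial. lra.
Qed.

Lemma last_index_satisfying (P : nat -> Prop) N : P O ->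
  exists m, (m <= N)%nat /\ P m /\ forall k, (m < k <= N)%nat -> ~ P k.
Proof.
  intros H0. induction N as [|N (m & Hm & Pm & Hk)].
  - exists O. repeat split; trivial. lia.
  - destruct (classic (P (S N))) as [HS|HS].
    + exists (S N). repeat split; trivial. lia.
    + exists m. repeat split; [lia|trivial|]. intros k Hlt.
      destruct (Nat.eq_dec k (S N)) as [->|]; trivial. apply Hk. lia.
Qed.

Lemma pow_eventually_ge q B : 1 < q -> exists N, (1 <= N)%nat /\ B <= q ^ N.
Proof.
  intros Hq. destruct (INR_eventually_ge (B / (q - 1))) as [N HN]. exists (S N).
  split; [lia|]. specialize (HN (S N) ltac:(lia)).
  (* Bernoulli's inequality. *)
  pose proof (poly (S N) (q - 1) ltac:(lra)) as Hp.
  replace (1 + (q - 1)) with q in Hp by ring.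
  assert (B / (q - 1) * (q - 1) <= INR (S N) * (q - 1)) by (apply Rmult_le_compat_r; lra).
  replace (B / (q - 1) * (q - 1)) with B in * by (field; lra). lra.
Qed.

(** * Discretizing a curve *)

Section Chains.
Context {X : Type} (D : X -> X -> R) (HD : is_metric D).

(** A supremum argument over the parameters reachable by a chain with steps between r/2 and r, up to
    a remainder of at most r. The remainder becomes the last step, which alone may be short. *)
Lemma curve_chain g a b r : is_curve D g a b -> 0 < r ->
  exists n t, is_partition a b (S n) t /\
    (forall i, (i < n)%nat -> r / 2 <= D (g (t i)) (g (t (S i)))) /\
    (forall i, (i <= n)%nat -> D (g (t i)) (g (t (S i))) <= r).
Proof.
  intros [Hab C] Hr.
  set (chain := fun v n t => is_partition a v n t /\
    forall i, (i < n)%nat -> r / 2 <= D (g (t i)) (g (t (S i))) <= r).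
  set (E := fun u => a <= u <= b /\
    exists v n t, v <= u /\ chain v n t /\ D (g v) (g u) <= r).
  assert (Ea : E a).
  { split; [lra|]. exists a, O, (fun _ => a). split; [lra|]. split.
    - split; [repeat split|]; intros; lia.
    - rewrite (metric_refl D HD). lra. }
  destruct (completeness E) as [T [HT1 HT2]].
  { exists b. intros u [Hu _]. lra. }
  { exists a. exact Ea. }
  assert (HaT : a <= T) by (apply HT1, Ea).
  assert (HTb : T <= b) by (apply HT2; intros u [Hu _]; lra).
  (* Near [T] the curve then varies by at most r/2. So either g(v) is within r/2 of g(s), hence
     within r of g(u), or g(s) is appended as a new chain point. *)
  destruct (C T ltac:(lra) (r / 4) ltac:(lra)) as (eta & Heta & HC).
  assert (Hs : exists s, E s /\ T - eta < s).
  { apply NNPP. intros Hno. apply (Rlt_not_le T (T - eta)); [lra|].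
    apply HT2. intros u Hu. apply Rnot_lt_le. intros Hlt. apply Hno. eauto. }
  destruct Hs as (s & Es & Hs). assert (HsT : s <= T) by (apply HT1, Es).
  assert (Hext : forall u, s <= u <= b -> u < T + eta -> E u).
  { intros u Hu HuT. destruct Es as (Hsab & v & n & t & Hvs & Hc & Hv).
    split; [lra|].
    assert (Hsu : D (g s) (g u) <= r / 2).
    { pose proof (HC s ltac:(lra) ltac:(apply Rabs_def1; lra)).
      pose proof (HC u ltac:(lra) ltac:(apply Rabs_def1; lra)).
      pose proof (metric_tri D HD (g s) (g T) (g u)).
      rewrite (metric_sym D HD (g T)) in *. lra. }
    destruct (Rle_dec (D (g v) (g s)) (r / 2)) as [Hle|Hgt].
    - exists v, n, t. split; [lra|]. split; trivial.
      pose proof (metric_tri D HD (g v) (g s) (g u)). lra.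
    - exists s, (S n), (fun i => if Nat.leb i n then t i else s).
      split; [lra|]. split; [|lra].
      destruct Hc as ((H0 & Hn & Hm) & Hd).
      assert (Hlast : forall (P : R -> R -> Prop), P v s ->
        (forall i, (i < n)%nat -> P (t i) (t (S i))) ->
        forall i, (i < S n)%nat ->
          P (if Nat.leb i n then t i else s) (if Nat.leb (S i) n then t (S i) else s)).
      { intros P P1 P2 i Hi. rewrite (proj2 (Nat.leb_le i n)) by lia.
        destruct (Nat.leb_spec (S i) n); [apply P2; lia|].
        replace i with n by lia. rewrite Hn. exact P1. }
      split; [split; [|split]|].
      + exact H0.
      + rewrite (proj2 (Nat.leb_gt (S n) n)) by lia. reflexivity.
      + apply (Hlast (fun x y => x <= y)); trivial.
      + apply (Hlast (fun x y => r / 2 <= D (g x) (g y) <= r)); trivial. lra. }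
  assert (ETb : T = b).
  { destruct (Req_dec T b) as [|Hne]; trivial. exfalso.
    set (u := Rmin b (T + eta / 2)).
    assert (T < u) by (apply Rmin_glb_lt; lra).
    assert (u <= b) by apply Rmin_l. assert (u <= T + eta / 2) by apply Rmin_r.
    apply (Rlt_not_le u T); trivial. apply HT1, Hext; lra. }
  subst T. destruct (Hext b ltac:(lra) ltac:(lra)) as (_ & v & n & t & Hvb & Hc & Hv).
  destruct Hc as ((H0 & Hn & Hm) & Hd).
  exists n, (fun i => if Nat.leb i n then t i else b).
  assert (Hlast : forall (P : R -> R -> Prop), P v b ->
    (forall i, (i < n)%nat -> P (t i) (t (S i))) ->
    forall i, (i < S n)%nat ->
      P (if Nat.leb i n then t i else b) (if Nat.leb (S i) n then t (S i) else b)).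
  { intros P P1 P2 i Hi. rewrite (proj2 (Nat.leb_le i n)) by lia.
    destruct (Nat.leb_spec (S i) n); [apply P2; lia|].
    replace i with n by lia. rewrite Hn. exact P1. }
  split; [split; [|split]|split].
  - exact H0.
  - rewrite (proj2 (Nat.leb_gt (S n) n)) by lia. reflexivity.
  - apply (Hlast (fun x y => x <= y)); trivial.
  - intros i Hi. rewrite (proj2 (Nat.leb_le i n)), (proj2 (Nat.leb_le (S i) n)) by lia.
    apply Hd, Hi.
  - intros i Hi. apply (Hlast (fun x y => D (g x) (g y) <= r)); trivial; [|lia].
    intros j Hj. apply Hd, Hj.
Qed.

End Chains.

(** * Uniformity *)

Section UniformSpaces.
Context {X : Type} (d : X -> X -> R) (p : X) (eps delta M : R).
Hypothesis Hhyp : gromov_hyperbolic d delta.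
Hypothesis Heps : 0 < eps.
Hypothesis Hstar : roughly_starlike d M.

Notation rho := (rho_eps d p eps).
Notation de := (dist_eps d p eps).
Notation gp := (gromov_product d p).
Notation E x y := (exp (- eps * gromov_product d p x y)).

Let Hd : is_metric d := proj1 Hhyp.
Let Hgeod : geodesic_space d := proj1 (proj2 (proj2 (proj2 Hhyp))).
Let Hproper : proper_space d := proj1 (proj2 (proj2 Hhyp)).

Let d_tri := metric_tri d Hd.
Let d_sym := metric_sym d Hd.
Let d_nonneg := metric_nonneg d Hd.
Let e_tri := de_tri d p eps Hd Hgeod Heps.
Let e_sym := de_sym d p eps Hd Hgeod Heps.
Let e_nonneg := de_nonneg d p eps Hd Hgeod Heps.
Let e_lower := de_lower d p eps Hd Hgeod Heps.

(** Sequences defining boundary points eventually leave the ball of radius 1/eps about [z], where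
    [de_lower] applies. *)
Lemma dist_to_boundary_ge z :
  Rbar_le (exp (-1) * / eps * rho z) (dist_to_boundary de z).
Proof.
  apply (proj2 (Glb_Rbar_correct _)). intros r (xi & Hxi & ->).
  destruct (boundary_seq_unbounded d p eps delta Hhyp Heps xi Hxi (d p z + / eps)) as [N HN].
  apply (dist_to_bpt_ge d p eps delta Hhyp Heps z xi _ N (proj1 Hxi)).
  intros m Hm. specialize (HN m Hm). pose proof (e_lower z (xi m)) as L.
  pose proof (d_tri p z (xi m)).
  rewrite Rmin_left in L by lra. lra.
Qed.

Lemma dist_to_boundary_le : exists C, 0 < C /\
  forall z, Rbar_le (dist_to_boundary de z) (C * rho z).
Proof.
  destruct Hstar as [o Ho].
  (* One d(o,p) comes from changing the base point of the ray, the other from bounding d(p,z)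
     through [o]. M + 1 is the distance from [z] to some g(t), as the infimum may not be attained;
     it is paid once in the product and once in d(p,z). *)
  exists (2 / eps * exp (eps * (2 * d o p + 2 * (M + 1)))). split.
  { apply Rmult_lt_0_compat; [apply Rdiv_lt_0_compat; lra|apply exp_pos]. }
  intros z. destruct (Ho z) as (g & Hg & HM).
  assert (Ht : exists t, 0 <= t /\ d z (g t) <= M + 1).
  { apply NNPP. intros Hno.
    assert (HM' : Rbar_le (M + 1) M).
    { eapply Rbar_le_trans; [|exact HM]. apply (proj2 (Glb_Rbar_correct _)).
      intros r (t & Ht & ->). simpl. apply Rnot_lt_le. intros Hlt. apply Hno.
      exists t. split; [trivial|lra]. }
    simpl in HM'. lra. }
  destruct Ht as (t & Ht & Hzt).
  pose proof (ray_boundary_seq d p eps delta Hhyp Heps o g Hg) as Hb.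
  apply Rbar_le_trans with (dist_to_bpt de z (fun k => g (INR k))).
  { apply (proj1 (Glb_Rbar_correct _)). exists (fun k => g (INR k)). split; trivial. }
  destruct (INR_eventually_ge t) as [N HN].
  apply (dist_to_bpt_le d p eps delta Hhyp Heps z _ _ N (proj1 Hb)).
  intros m Hm. specialize (HN m Hm).
  eapply Rle_trans; [apply (de_le_exp d p eps delta Hhyp Heps)|].
  rewrite Rmult_assoc. apply Rmult_le_compat_l.
  { apply Rlt_le, Rdiv_lt_0_compat; lra. }
  unfold rho_eps. rewrite <- exp_plus. apply exp_monotone.
  pose proof (ray_gromov_product d p delta Hhyp o g t (INR m) Hg Ht (pos_INR m)) as H1.
  rewrite Rmin_left in H1 by lra.
  pose proof (gromov_product_lipschitz d p delta Hhyp (g t) z (g (INR m))) as H2.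
  rewrite (d_sym (g t)) in H2.
  pose proof (d_tri p o z) as H3. rewrite (d_sym p o) in H3.
  pose proof (d_tri o (g t) z) as H4. rewrite (d_sym (g t)) in H4.
  destruct Hg as [G0 G]. rewrite <- G0 in H4 at 2. rewrite G in H4 by lra.
  rewrite Rabs_left1 in H4 by lra. nra.
Qed.

Lemma uniformization_noncomplete : noncomplete de.
Proof.
  destruct Hstar as [o Ho]. destruct (Ho p) as (g & Hg & _).
  exists (fun k => g (INR k)). apply (ray_boundary_seq d p eps delta Hhyp Heps o), Hg.
Qed.

(** By [de_lower] a small [de]-ball about x lies in the [d]-ball of radius 1/eps, which is compact,
    and [d]-convergence implies [de]-convergence. *)
Lemma uniformization_locally_compact : locally_compact de.
Proof.
  intros x. assert (Hie : 0 < / eps) by (apply Rinv_0_lt_compat, Heps).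
  set (r0 := exp (-1) * rho x * / eps).
  assert (Hr0 : 0 < r0).
  { repeat apply Rmult_lt_0_compat; trivial; [apply exp_pos|apply rho_pos]. }
  exists (r0 / 2). split; [lra|]. intros u Hu.
  destruct (Hproper x (/ eps) u) as (phi & z & Hphi & _ & Hz).
  { intros n. apply Rnot_lt_le. intros Hlt. pose proof (e_lower x (u n)) as L.
    rewrite Rmin_left in L by lra. fold r0 in L. specialize (Hu n). lra. }
  assert (Hz' : forall e, 0 < e -> exists N, forall n, (N <= n)%nat -> de (u (phi n)) z < e).
  { intros e He. destruct (proj1 (lim_seq_0_iff _) Hz e He) as [N HN]. exists N.
    intros n Hn. specialize (HN n Hn). apply Rabs_def2 in HN.
    pose proof (de_le_d d p eps Hd Hgeod Heps (u (phi n)) z). lra. }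
  exists phi, z. split; [trivial|]. split.
  - apply le_epsilon. intros e He. destruct (Hz' e He) as [N HN].
    specialize (HN N (le_n N)). specialize (Hu (phi N)).
    pose proof (e_tri x (u (phi N)) z). lra.
  - apply lim_seq_0_iff. intros e He. destruct (Hz' e He) as [N HN]. exists N.
    intros n Hn. rewrite Rabs_right by apply Rle_ge, e_nonneg. auto.
Qed.

(** Counterpart of the exponential upper bounds: the center is within (x|y)_p + 2 delta of p, and
    moving along the geodesic changes the distance to p at unit rate at most. *)
Lemma geodesic_center_rho g x y t : is_geodesic d g x y -> 0 <= t <= d x y ->
  E x y * exp (- eps * Rabs (t - geodesic_center d p x y)) <=
  exp (eps * (2 * delta)) * rho (g t).
Proof.
  intros Hg Ht. unfold rho_eps. rewrite <- !exp_plus. apply exp_monotone.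
  pose proof (geodesic_center_dist_base_le d p delta Hhyp g x y Hg) as H1.
  pose proof (geodesic_center_bounds d p delta Hhyp x y) as Hc.
  pose proof (d_tri p (g (geodesic_center d p x y)) (g t)) as H2.
  destruct Hg as (_ & _ & G). rewrite (G (geodesic_center d p x y) t) in H2 by lra.
  rewrite Rabs_minus_sym in H2. nra.
Qed.

Lemma GH_theorem_uniform_space : GH_theorem d de -> uniform_space de.
Proof.
  intros (A & HA & HGH). split; [apply uniformization_noncomplete|].
  split; [apply uniformization_locally_compact|].
  assert (Hie : 0 < / eps) by (apply Rinv_0_lt_compat, Heps).
  set (c := exp (-1) * / eps). assert (Hc : 0 < c).
  { apply Rmult_lt_0_compat; trivial. apply exp_pos. }
  (* Chosen so that B c rho = e^(2 eps delta) rho / eps, which bounds the shorter subarc at each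
     point. *)
  set (B := exp (eps * (2 * delta)) / eps / c).
  assert (HB : 0 < B).
  { apply Rdiv_lt_0_compat; trivial. apply Rdiv_lt_0_compat; trivial. apply exp_pos. }
  exists (A + B). split; [lra|]. intros x y. destruct (Hgeod x y) as [g Hg].
  exists g, 0, (d x y). split; [apply Hg|]. split; [apply Hg|].
  split; [|split].
  - split; [apply d_nonneg|]. intros t Ht e He. exists e. split; trivial.
    intros s Hs Hst. eapply Rle_lt_trans; [apply (de_le_d d p eps Hd Hgeod Heps)|].
    rewrite (proj2 (proj2 Hg)) by trivial. exact Hst.
  - eapply Rbar_le_trans; [apply HGH, Hg|].
    destruct Hg as (G0 & G1 & _). rewrite G0, G1. simpl.
    pose proof (e_nonneg x y). nra.
  - intros t Ht.
    apply Rbar_le_trans with ((A + B) * (c * rho (g t)));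
      [|apply Rbar_mult_pos_ge; [lra|apply dist_to_boundary_ge]].
    apply Rbar_le_trans with
      (E x y * exp (- eps * Rabs (t - geodesic_center d p x y)) / eps).
    + destruct (Rle_dec t (geodesic_center d p x y)) as [Hle|Hgt].
      * eapply Rbar_le_trans; [apply Rbar_min_l|].
        rewrite Rabs_left1, Ropp_minus_distr by lra.
        apply (geodesic_initial_length d p eps delta Hhyp Heps g x y t Hg). lra.
      * eapply Rbar_le_trans; [apply Rbar_min_r|].
        rewrite Rabs_right by lra.
        apply (geodesic_final_length d p eps delta Hhyp Heps g x y t Hg). lra.
    + simpl. pose proof (geodesic_center_rho g x y t Hg Ht) as H.
      pose proof (rho_pos d p eps (g t)) as Hr.
      apply Rle_trans with (exp (eps * (2 * delta)) * rho (g t) / eps).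
      * apply Rmult_le_compat_r; [lra|exact H].
      * replace (exp (eps * (2 * delta)) * rho (g t) / eps) with (B * (c * rho (g t)))
          by (unfold B; field; lra).
        apply Rmult_le_compat_r; [|lra]. apply Rmult_le_pos; lra.
Qed.

(* One step back by N indices gains a factor q ^ N >= exp (eps * delta), which
   pays for the loss in the four-point condition. *)
Lemma growing_chain_gromov_product K q : 0 < K -> 1 < q -> exists K', 0 < K' /\
  forall (b : nat -> X) (s : nat -> R) J,
    (forall j, (j < J)%nat -> d (b j) (b (S j)) <= 1) ->
    (forall j, (j <= J)%nat -> rho (b j) <= K * s j) ->
    (forall j, (j < J)%nat -> q * s j <= s (S j)) ->
    forall j, (j <= J)%nat -> E (b O) (b j) <= K' * s j.
Proof.
  intros HK Hq. destruct (pow_eventually_ge q (exp (eps * delta)) Hq) as (N & HN1 & HN).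
  (* Constant for indices at most [N] apart, whose points have [d]-distance at most N. *)
  set (K0 := exp (eps * INR N) * K).
  assert (HK0 : 0 < K0) by (apply Rmult_lt_0_compat; trivial; apply exp_pos).
  exists (exp (eps * delta) * K0).
  split; [apply Rmult_lt_0_compat; trivial; apply exp_pos|].
  intros b s J Hstep Hrho Hgrow.
  assert (Hs : forall j, (j <= J)%nat -> 0 < s j).
  { intros j Hj. specialize (Hrho j Hj). pose proof (rho_pos d p eps (b j)). nra. }
  assert (Hdist : forall k i, (i + k <= J)%nat -> d (b i) (b (i + k)%nat) <= INR k).
  { induction k; intros i Hi.
    - rewrite Nat.add_0_r, (metric_refl d Hd). simpl. lra.
    - rewrite S_INR, Nat.add_succ_r.
      pose proof (d_tri (b i) (b (i + k)%nat) (b (S (i + k)))).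
      specialize (IHk i ltac:(lia)). specialize (Hstep (i + k)%nat ltac:(lia)). lra. }
  assert (Hpow : forall k i, (i + k <= J)%nat -> q ^ k * s i <= s (i + k)%nat).
  { induction k; intros i Hi.
    - rewrite Nat.add_0_r. simpl. lra.
    - rewrite Nat.add_succ_r. simpl. specialize (IHk i ltac:(lia)).
      specialize (Hgrow (i + k)%nat ltac:(lia)).
      apply Rle_trans with (q * s (i + k)%nat); trivial.
      rewrite Rmult_assoc. apply Rmult_le_compat_l; lra. }
  assert (Hnear : forall k i, (k <= N)%nat -> (i + k <= J)%nat ->
    E (b i) (b (i + k)%nat) <= K0 * s (i + k)%nat).
  { intros k i Hk Hi. rewrite (gromov_product_sym d p delta Hhyp).
    eapply Rle_trans; [apply (exp_gromov_product_near d p eps delta Hhyp Heps)|].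
    unfold K0. rewrite Rmult_assoc. apply Rmult_le_compat.
    - apply Rlt_le, exp_pos.
    - apply rho_nonneg.
    - apply exp_monotone. specialize (Hdist k i Hi). rewrite d_sym.
      apply le_INR in Hk. apply Rmult_le_compat_l; lra.
    - apply Hrho, Hi. }
  assert (H1 : 1 <= exp (eps * delta)).
  { rewrite <- exp_0. apply exp_monotone. apply Rmult_le_pos; [lra|].
    apply (hyperbolicity_constant_nonneg d p delta Hhyp). }
  (* Beyond [N] the induction passes through index j - N: the gain q^N in [s] cancels the factor
     lost there. *)
  intros j. induction j as [j IH] using lt_wf_ind. intros Hj.
  destruct (Nat.le_gt_cases j N) as [Hle|Hgt].
  - pose proof (Hnear j O Hle Hj) as Hn. simpl in Hn.
    assert (0 < K0 * s j) by (apply Rmult_lt_0_compat; auto). nra.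
  - set (i := (j - N)%nat). assert (Hij : (i + N = j)%nat) by lia.
    specialize (IH i ltac:(lia) ltac:(lia)).
    specialize (Hnear N i (le_n N) ltac:(lia)). rewrite Hij in Hnear.
    specialize (Hpow N i ltac:(lia)). rewrite Hij in Hpow.
    rewrite Rmult_assoc.
    apply (exp_gromov_product_hyp d p eps delta Hhyp Heps _ (b i)); trivial.
    eapply Rle_trans; [exact IH|].
    replace (exp (eps * delta) * K0 * s i) with (K0 * (exp (eps * delta) * s i)) by ring.
    apply Rmult_le_compat_l; [lra|].
    eapply Rle_trans; [|exact Hpow]. apply Rmult_le_compat_r; trivial.
    apply Rlt_le, Hs. lia.
Qed.

Lemma exp_gromov_product_lipschitz x y y' :
  E x y' <= exp (eps * d y y') * E x y.
Proof.
  rewrite <- exp_plus. apply exp_monotone.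
  pose proof (gromov_product_lipschitz d p delta Hhyp y y' x) as H.
  rewrite (gromov_product_sym d p delta Hhyp y), (gromov_product_sym d p delta Hhyp y') in H.
  nra.
Qed.

(** As long as the initial sum S_k is the smaller one, l_k >= kappa rho(a_k) >= (kappa/K0) S_k, so
    the initial sums grow by the factor q; beyond the middle the tail sums do so in reverse order.
    [growing_chain_gromov_product] controls both halves. *)
Lemma uniform_chain_gromov_product kappa K0 : 0 < kappa -> 0 < K0 -> exists K, 0 < K /\
  forall (a : nat -> X) (l : nat -> R) n, (1 <= n)%nat ->
    (forall i, (i <= n)%nat -> 0 <= l i) ->
    (forall i, (i <= n)%nat -> d (a i) (a (S i)) <= 1) ->
    (forall i, (i < n)%nat -> kappa * rho (a i) <= l i /\ kappa * rho (a (S i)) <= l i) ->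
    (forall k, (k <= n)%nat ->
       Rmin (sumlt l k) (sumlt l (S n) - sumlt l k) <= K0 * rho (a k)) ->
    E (a O) (a (S n)) <= K * sumlt l (S n).
Proof.
  intros Hk HK0.
  set (q := 1 + kappa / K0).
  assert (HkK : 0 < kappa / K0) by (apply Rdiv_lt_0_compat; trivial).
  destruct (growing_chain_gromov_product (/ kappa) q) as (K & HK & Hchain).
  { apply Rinv_0_lt_compat, Hk. }
  { unfold q. lra. }
  exists (exp eps * (exp (eps * delta) * (exp eps * K))). split.
  { repeat apply Rmult_lt_0_compat; trivial; apply exp_pos. }
  intros a l n Hn Hl Hstep Hlen Hmin.
  set (L := sumlt l (S n)) in *.
  assert (Hmono : forall i j, (i <= j)%nat -> (j <= S n)%nat -> sumlt l i <= sumlt l j).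
  { intros i j Hij. induction Hij; intros Hj; [lra|]. simpl.
    specialize (IHHij ltac:(lia)). specialize (Hl m ltac:(lia)). lra. }
  assert (Hrho : forall r w, kappa * r <= w -> r <= / kappa * w).
  { intros r w H. replace r with (/ kappa * (kappa * r)) by (field; lra).
    apply Rmult_le_compat_l; trivial. apply Rlt_le, Rinv_0_lt_compat, Hk. }
  assert (Hgain : forall r w v, kappa * r <= w -> v <= K0 * r -> q * v <= v + w).
  { intros r w v H1 H2. unfold q.
    assert (kappa / K0 * v <= kappa / K0 * (K0 * r)) by (apply Rmult_le_compat_l; lra).
    replace (kappa / K0 * (K0 * r)) with (kappa * r) in * by (field; lra). lra. }
  (* The range up to n - 1 ensures that the index [S m] starting the second half is at most n. *)
  destruct (last_index_satisfying (fun k => sumlt l k <= L - sumlt l k) (n - 1))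
    as (m & Hm & Pm & Hafter).
  { simpl. pose proof (Hmono O (S n) ltac:(lia) ltac:(lia)) as H. simpl sumlt at 1 in H.
    fold L in H. lra. }
  assert (HL0 : 0 <= L) by (apply (Hmono O (S n)); lia).
  assert (F : E (a O) (a m) <= K * L).
  { apply Rle_trans with (K * sumlt l (S m)).
    2:{ apply Rmult_le_compat_l; [lra|]. apply Hmono; lia. }
    (* Shifted by one, so that already the first value l_0 dominates rho(a_0). *)
    apply (Hchain a (fun j => sumlt l (S j)) m); [| | |lia].
    - intros j Hj. apply Hstep. lia.
    - intros j Hj. apply Hrho. destruct (Hlen j ltac:(lia)) as [H _]. simpl.
      pose proof (Hmono O j ltac:(lia) ltac:(lia)) as H0. simpl in H0. lra.
    - intros j Hj. change (sumlt l (S (S j))) with (sumlt l (S j) + l (S j)).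
      apply (Hgain (rho (a (S j)))).
      + apply Hlen. lia.
      + specialize (Hmin (S j) ltac:(lia)). rewrite Rmin_left in Hmin; trivial.
        pose proof (Hmono (S j) m ltac:(lia) ltac:(lia)). lra. }
  assert (B : E (a n) (a (S m)) <= K * L).
  { set (b := fun j => a (n - j)%nat). set (s := fun j => L - sumlt l (n - S j)).
    assert (HB : E (b O) (b (n - S m)%nat) <= K * s (n - S m)%nat).
    { apply (Hchain b s (n - S m)%nat); [| | |lia].
      - intros j Hj. unfold b. rewrite d_sym.
        replace (n - j)%nat with (S (n - S j)) by lia. apply Hstep. lia.
      - intros j Hj. apply Hrho. unfold b, s. set (i := (n - S j)%nat).
        replace (n - j)%nat with (S i) by lia.
        destruct (Hlen i ltac:(lia)) as [_ H].
        pose proof (Hmono (S i) (S n) ltac:(lia) ltac:(lia)) as H0. fold L in H0.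
        simpl sumlt at 1 in H0. lra.
      - intros j Hj. unfold s. set (i := (n - S (S j))%nat).
        replace (n - S j)%nat with (S i) by lia.
        replace (L - sumlt l i) with (L - sumlt l (S i) + l i) by (simpl; ring).
        apply (Hgain (rho (a (S i)))).
        + apply Hlen. lia.
        + specialize (Hmin (S i) ltac:(lia)).
          pose proof (Hafter (S i) ltac:(lia)).
          rewrite Rmin_right in Hmin; trivial. lra. }
    unfold b, s in HB. rewrite Nat.sub_0_r in HB.
    replace (n - (n - S m))%nat with (S m) in HB by lia.
    eapply Rle_trans; [exact HB|]. apply Rmult_le_compat_l; [lra|].
    pose proof (Hmono O (n - S (n - S m))%nat ltac:(lia) ltac:(lia)) as H.
    simpl sumlt at 1 in H. lra. }
  assert (He1 : 1 <= exp eps) by (rewrite <- exp_0; apply exp_monotone; lra).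
  assert (HKL : 0 <= K * L) by (apply Rmult_le_pos; lra).
  assert (Hlip : forall x i Q, (i <= n)%nat -> E x (a i) <= Q ->
    E x (a (S i)) <= exp eps * Q).
  { intros x i Q Hi HQ. eapply Rle_trans; [apply (exp_gromov_product_lipschitz x (a i))|].
    apply Rmult_le_compat; trivial; try (apply Rlt_le, exp_pos).
    apply exp_monotone. specialize (Hstep i Hi). nra. }
  (* The halves are joined at a_(m+1), reached from a_m at the cost e^eps; the same cost leads from
     a_n to the endpoint. *)
  rewrite !Rmult_assoc. apply Hlip; [lia|].
  apply (exp_gromov_product_hyp d p eps delta Hhyp Heps _ (a (S m))).
  - apply Hlip; [lia|exact F].
  - rewrite (gromov_product_sym d p delta Hhyp). nra.
Qed.

(** [de_lower] at g(t) turns a small [de]-distance into a small [d]-distance. *)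
Lemma is_curve_of_de g a b : is_curve de g a b -> is_curve d g a b.
Proof.
  intros [Hab C]. split; trivial. intros t Ht e He.
  pose proof (Rmin_inv_eps_pos eps Heps e He) as Hm.
  assert (H0 : 0 < exp (-1) * rho (g t)).
  { apply Rmult_lt_0_compat; [apply exp_pos|apply rho_pos]. }
  destruct (C t Ht (exp (-1) * rho (g t) * Rmin (/ eps) e)) as (eta & Heta & H).
  { apply Rmult_lt_0_compat; trivial. }
  exists eta. split; trivial. intros s Hs Hst. specialize (H s Hs Hst).
  rewrite e_sym in H. rewrite d_sym. apply Rnot_le_lt. intros Hle.
  pose proof (e_lower (g t) (g s)) as L.
  assert (exp (-1) * rho (g t) * Rmin (/ eps) e <=
          exp (-1) * rho (g t) * Rmin (/ eps) (d (g t) (g s))).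
  { apply Rmult_le_compat_l; [lra|]. apply Rle_min_compat_l, Hle. }
  lra.
Qed.

Lemma uniform_space_GH_theorem : uniform_space de -> GH_theorem d de.
Proof.
  intros (_ & _ & A & HA & Hunif).
  destruct dist_to_boundary_le as (C & HC & Hbd).
  (* The factor in [de_lower] for points at distance at least 1/2, the minimal step of the chain. *)
  set (kappa := exp (-1) * Rmin (/ eps) (1 / 2)).
  assert (Hkappa : 0 < kappa).
  { apply Rmult_lt_0_compat; [apply exp_pos|]. apply (Rmin_inv_eps_pos eps Heps). lra. }
  assert (HAC : 0 < A * C) by (apply Rmult_lt_0_compat; trivial).
  destruct (uniform_chain_gromov_product kappa (A * C) Hkappa HAC) as (K & HK & Hchain).
  assert (HKA : 0 < K * A) by (apply Rmult_lt_0_compat; trivial).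
  apply (GH_theorem_of_lower_bound d p eps delta Hhyp Heps (/ (K * A)) 1);
    [apply Rinv_0_lt_compat, HKA|lra|].
  intros x y Hxy. destruct (Hunif x y) as (g & a & b & Hx & Hy & Hc & Hlen & Hmin).
  destruct (curve_chain d Hd g a b 1 (is_curve_of_de g a b Hc) ltac:(lra))
    as (n & t & Ht & Hlow & Hup).
  set (l := fun i => de (g (t i)) (g (t (S i)))).
  assert (Ha : g (t O) = x) by (rewrite (proj1 Ht); exact Hx).
  assert (Hb : g (t (S n)) = y) by (rewrite (proj1 (proj2 Ht)); exact Hy).
  assert (HL : sumlt l (S n) <= A * de x y).
  { pose proof (Rbar_le_trans _ _ _ (curve_length_ge_sum de g _ _ _ _ Ht) Hlen) as H.
    rewrite Hx, Hy in H. exact H. }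
  (* A single step of size at most 1 cannot join points more than 1 apart. *)
  assert (Hn : (1 <= n)%nat).
  { destruct n; [|lia]. specialize (Hup O (le_n _)). rewrite Ha, Hb in Hup. lra. }
  assert (HE : E x y <= K * sumlt l (S n)).
  { rewrite <- Ha, <- Hb. apply (Hchain (fun i => g (t i)) l n); trivial.
    - intros i _. apply e_nonneg.
    - assert (H : forall u v, 1 / 2 <= d u v -> kappa * rho u <= de u v).
      { intros u v Huv. eapply Rle_trans; [|apply e_lower]. unfold kappa.
        replace (exp (-1) * Rmin (/ eps) (1 / 2) * rho u) with
          (exp (-1) * rho u * Rmin (/ eps) (1 / 2)) by ring.
        apply Rmult_le_compat_l.
        - apply Rmult_le_pos; [apply Rlt_le, exp_pos|apply rho_nonneg].
        - apply Rle_min_compat_l, Huv. }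
      intros i Hi. split; [apply H, Hlow, Hi|].
      unfold l. rewrite e_sym. apply H. rewrite d_sym. apply Hlow, Hi.
    (* The two partial sums are at most the [de]-lengths of the two subarcs, the smaller of which is
       at most A times the boundary distance, hence at most A C rho. *)
    - intros k Hk.
      assert (Hs1 : Rbar_le (sumlt l k) (curve_length de g a (t k))).
      { apply (curve_length_ge_sum de g a (t k) k t).
        destruct Ht as (T0 & T1 & T2). repeat split; trivial. intros; apply T2; lia. }
      assert (Hs2 : Rbar_le (sumlt l (S n) - sumlt l k) (curve_length de g (t k) b)).
      { replace (sumlt l (S n) - sumlt l k) with
          (sumlt (fun i => l (k + i)%nat) (S n - k)).
        2:{ replace (S n) with (k + (S n - k))%nat at 2 by lia. rewrite sumlt_cat. ring. }
        eapply Rbar_le_trans;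
          [|apply (curve_length_ge_sum de g (t k) b (S n - k) (fun i => t (k + i)%nat))].
        - apply Req_le, sumlt_ext. intros i _. unfold l. rewrite Nat.add_succ_r. reflexivity.
        - destruct Ht as (T0 & T1 & T2). split; [f_equal; lia|]. split.
          + rewrite <- T1. f_equal. lia.
          + intros i Hi. rewrite Nat.add_succ_r. apply T2. lia. }
      specialize (Hmin (t k) (partition_bounds _ _ _ _ Ht k ltac:(lia))).
      pose proof (Rbar_le_trans _ _ _ Hmin
        (Rbar_mult_pos_le A _ _ HA (Hbd (g (t k))))) as Hfin.
      rewrite <- Rmult_assoc in Hfin.
      revert Hfin. apply Rbar_min_case; intros Hfin.
      + eapply Rle_trans; [apply Rmin_l|]. exact (Rbar_le_trans _ _ _ Hs1 Hfin).
      + eapply Rle_trans; [apply Rmin_r|]. exact (Rbar_le_trans _ _ _ Hs2 Hfin). }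
  apply Rmult_le_reg_l with (K * A); trivial.
  rewrite <- Rmult_assoc, Rinv_r, Rmult_1_l by lra.
  eapply Rle_trans; [exact HE|]. rewrite Rmult_assoc.
  apply Rmult_le_compat_l; lra.
Qed.

End UniformSpaces.

Theorem theorem1p3 (X : Type) (d : X -> X -> R) (delta M : R)
  (Hdelta : 0 <= delta) (HM : 0 <= M)
  (Hhyp : gromov_hyperbolic d delta) (Hstar : roughly_starlike d M)
  (p : X) (eps : R) (Heps : 0 < eps) :
  let de := dist_eps d p eps in
  (GH_boundary_points d de <->
     (Phi_bijective d de p /\ GH_gromov_seq d de p)) /\
  ((Phi_bijective d de p /\ GH_gromov_seq d de p) <-> GH_theorem d de) /\
  (GH_theorem d de <-> uniform_space de).
Proof.
  intros de.
  assert (H12 : GH_boundary_points d de -> Phi_bijective d de p /\ GH_gromov_seq d de p).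
  { intros H. split.
    - apply (GH_boundary_points_Phi_bijective d p eps delta Hhyp Heps H).
    - apply (GH_boundary_points_gromov_seq d p eps delta Hhyp Heps H). }
  assert (H23 : Phi_bijective d de p /\ GH_gromov_seq d de p -> GH_theorem d de).
  { intros [H1 H2]. apply (GH_gromov_seq_GH_theorem d p eps delta Hhyp Heps H1 H2). }
  assert (H31 : GH_theorem d de -> GH_boundary_points d de).
  { apply (GH_theorem_boundary_points d p eps delta Hhyp Heps). }
  (* [auto] composes the cycle (1), (2), (3), (1); the two directions between (3) and (4) remain. *)
  split; [|split]; split; auto.
  - apply (GH_theorem_uniform_space d p eps delta M Hhyp Heps Hstar).
  - apply (uniform_space_GH_theorem d p eps delta M Hhyp Heps Hstar).
Qed.
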